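(* Let $d \ge 1$, let $0<\lambda\le\Lambda$, and let $F$ be uniformly elliptic with constants $\lambda,\Lambda$. There is no continuous function $u : Q_1 \to \mathbb R$ such that all of the following hold: $u$ is a viscosity solution of $u_t - F(D^2 u) = 0$ in $Q_1$; $u$ is real analytic in $(t,x)$ on $Q_1 \setminus \{(0,0)\}$ (at points with $t=0$ this means $u$ coincides near the point with a real-analytic function of $(t,x)$ defined in a full neighborhood); the function $x \mapsto u(0,x)$ is homogeneous of degree two on $B_1$ (i.e. $u(0,ax) = a^2 u(0,x)$ whenever $a>0$ and $x, ax \in B_1$); and $x\mapsto u(0,x)$ is not $C^2$ in any neighborhood of $x=0$.
   Context: $B_1$ is the open unit ball of $\mathbb R^d$ and $Q_1 := (-1,0] \times B_1$. A function $F$ on real symmetric $d\times d$ matrices is uniformly elliptic with constants $0<\lambda\le\Lambda$ if for all symmetric $A,B$ with $B \ge 0$, $\lambda \operatorname{tr} B \le F(A+B) - F(A) \le \Lambda \operatorname{tr} B$. $D^2u$ denotes the spatial Hessian. *)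

(* Defs.v *)
From HB Require Import structures.
From mathcomp Require Import all_boot all_order all_algebra.
From mathcomp Require Import all_classical all_reals all_analysis.
Unset Printing Implicit Defensive.
Import Order.TTheory GRing.Theory Num.Theory.
Import numFieldNormedType.Exports.
Local Open Scope classical_set_scope.
Local Open Scope ring_scope.

Definition symmetric_mx {R : realType} {d : nat} (A : 'M[R]_d) : Prop := A^T = A.
Definition psd_mx {R : realType} {d : nat} (B : 'M[R]_d) : Prop :=
  forall v : 'rV[R]_d, 0 <= (v *m B *m v^T) 0 0.

Definition unif_elliptic {R : realType} {d : nat} (F : 'M[R]_d -> R) (lam Lam : R) : Prop :=
  forall A B : 'M[R]_d, symmetric_mx A -> symmetric_mx B -> psd_mx B ->
    lam * \tr B <= F (A + B) - F A /\ F (A + B) - F A <= Lam * \tr B.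

Definition sqnorm {R : realType} {d : nat} (x : 'rV[R]_d) : R := \sum_(i < d) x 0 i ^+ 2.
Definition eball {R : realType} (d : nat) (r : R) : set 'rV[R]_d :=
  [set x | sqnorm x < r ^+ 2].
Definition B1 {R : realType} (d : nat) : set 'rV[R]_d := eball d 1.
Definition Q1 {R : realType} (d : nat) : set (R * 'rV[R]_d) :=
  [set p | -1 < p.1 <= 0 /\ B1 d p.2].

Definition evec {R : realType} {d : nat} (i : 'I_d) : 'rV[R]_d := delta_mx 0 i.
Definition pdt {R : realType} {d : nat} (f : R -> 'rV[R]_d -> R) : R -> 'rV[R]_d -> R :=
  fun t x => derive (fun s : R => f s x) t 1.
Definition pdx {R : realType} {d : nat} (i : 'I_d) (f : R -> 'rV[R]_d -> R)
  : R -> 'rV[R]_d -> R :=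
  fun t x => derive (f t) x (evec i).
Definition hess {R : realType} {d : nat} (f : R -> 'rV[R]_d -> R) (t : R) (x : 'rV[R]_d)
  : 'M[R]_d := \matrix_(i, j) pdx i (pdx j f) t x.

Definition jcont {R : realType} {d : nat} (f : R -> 'rV[R]_d -> R) : Prop :=
  continuous (fun p : R * 'rV[R]_d => f p.1 p.2).

Definition C12 {R : realType} {d : nat} (phi : R -> 'rV[R]_d -> R) : Prop :=
  (forall t x, derivable (fun s : R => phi s x) t 1) /\
  (forall t x i, derivable (phi t) x (evec i)) /\
  (forall t x i j, derivable (pdx j phi t) x (evec i)) /\
  jcont phi /\ jcont (pdt phi) /\ (forall i, jcont (pdx i phi)) /\
  (forall i j, jcont (pdx i (pdx j phi))).

Definition touches_above {R : realType} {d : nat} (u phi : R -> 'rV[R]_d -> R)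
  (p0 : R * 'rV[R]_d) : Prop :=
  \forall p \near p0, Q1 d p -> u p.1 p.2 - phi p.1 p.2 <= u p0.1 p0.2 - phi p0.1 p0.2.
Definition touches_below {R : realType} {d : nat} (u phi : R -> 'rV[R]_d -> R)
  (p0 : R * 'rV[R]_d) : Prop :=
  \forall p \near p0, Q1 d p -> u p.1 p.2 - phi p.1 p.2 >= u p0.1 p0.2 - phi p0.1 p0.2.

Definition visc_solution {R : realType} {d : nat} (F : 'M[R]_d -> R)
  (u : R -> 'rV[R]_d -> R) : Prop :=
  {within Q1 d, continuous (fun p : R * 'rV[R]_d => u p.1 p.2)} /\
  (forall p0 phi, Q1 d p0 -> C12 phi -> touches_above u phi p0 ->
     pdt phi p0.1 p0.2 - F (hess phi p0.1 p0.2) <= 0) /\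
  (forall p0 phi, Q1 d p0 -> C12 phi -> touches_below u phi p0 ->
     pdt phi p0.1 p0.2 - F (hess phi p0.1 p0.2) >= 0).

Definition coords {R : realType} {d : nat} (p : R * 'rV[R]_d) : 'I_d.+1 -> R :=
  fun i => if unlift ord0 i is Some j then p.2 0 j else p.1.
Definition monom {R : realType} {n : nat} (y : 'I_n -> R) (a : 'I_n -> nat) : R :=
  \prod_(i < n) y i ^+ a i.
Definition psum {R : realType} {n : nat} (c : ('I_n -> nat) -> R) (y : 'I_n -> R) (N : nat) : R :=
  \sum_(a : {ffun 'I_n -> 'I_N.+1} | (\sum_(i < n) (a i : nat) <= N)%N)
     c (fun i => a i : nat) * monom y (fun i => a i : nat).

(* u coincides, on Q1 near p0, with a function given in a full neighbourhood
   (polydisc of radius r) of p0 by an absolutely convergent power series *)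
Definition analytic_at_Q1 {R : realType} {d : nat} (u : R -> 'rV[R]_d -> R)
  (p0 : R * 'rV[R]_d) : Prop :=
  exists (r : R) (c : ('I_d.+1 -> nat) -> R), 0 < r /\
    let y p := fun i => coords p i - coords p0 i in
    (forall p, (forall i, `|y p i| < r) ->
       exists M : R, forall N, psum (fun a => `|c a|) (fun i => `|y p i|) N <= M) /\
    (forall p, (forall i, `|y p i| < r) -> Q1 d p ->
       psum c (y p) N @[N --> \oo] --> u p.1 p.2).

Definition pdx1 {R : realType} {d : nat} (i : 'I_d) (g : 'rV[R]_d -> R) : 'rV[R]_d -> R :=
  fun x => derive g x (evec i).
Definition C2_on {R : realType} {d : nat} (g : 'rV[R]_d -> R) (A : set 'rV[R]_d) : Prop :=
  forall x, A x ->
    (forall i, derivable g x (evec i)) /\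
    (forall i j, derivable (pdx1 j g) x (evec i)) /\
    {for x, continuous g} /\
    (forall i, {for x, continuous (pdx1 i g)}) /\
    (forall i j, {for x, continuous (pdx1 i (pdx1 j g))}).

(* Main.v *)
(* For [0 < a <= 1] the rescaling [u_a(t,x) = a^-2 u(a^2 t, a x)] solves the same
   equation and agrees with [u] at [t = 0]. Since [F] is Lipschitz, the difference
   [V = u - u_a] satisfies [|V_t| <= C |D^2 V|]; being analytic near [(0,x)], [x <> 0],
   it vanishes to infinite order in time there, hence along the whole time line
   through [x]. So [u] is parabolically homogeneous of degree two and [w = u_t] of
   degree zero. The function [w] solves a linear uniformly parabolic equation, and
   in the variable [rho = |x|^2 / (-t)] there is an unbounded strict supersolution
   [c rho - exp (- k rho)] on [rho >= delta]; comparison on scaling classes bounds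
   [w] by its maximum on [rho = delta], and [delta -> 0] yields
   [w(t,x) <= w(-1/2,0)]. Applied to [-u] as well, this makes [u_t] constant, so
   [u(0,.)] differs by a constant from [u(-1/2,.)], which is analytic at the origin. *)
Require Import Defs.
From HB Require Import structures.
From mathcomp Require Import all_boot all_order all_algebra.
From mathcomp Require Import all_classical all_reals all_analysis.
From mathcomp Require Import zify ring lra.
Set Implicit Arguments.
Unset Strict Implicit.
Unset Printing Implicit Defensive.
Import Order.TTheory GRing.Theory Num.Theory.
Import numFieldNormedType.Exports.
Local Open Scope classical_set_scope.
Local Open Scope ring_scope.

(** * Multivariate power series *)

(** Two restrictions shape the argument. Nothing is known about [u] for [t > 0], while [derive] is
    two-sided; so time derivatives of [u] are used only at [t < 0], and its behaviour in time at
    [t = 0] is read off the power series. And [F] is merely monotone and Lipschitz, so the equation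
    cannot be differentiated: the linear inequality for [w] comes from comparing [F] at the Hessians
    of [u] at two nearby times. The two terms of the barrier have separate tasks. A multiple of
    [rho] is guaranteed to be a supersolution only for [rho >= 2 d Lam]; it keeps maxima away from
    [rho = +oo], that is from [t = 0]. Below that threshold the concavity of [- exp (- k rho)]
    supplies strictness through [lam], but this gain carries a factor [rho], which degenerates on
    the axis [x = 0]; hence the cut at [rho = delta]. Scale invariance of [w] replaces the region
    [rho >= delta] by one sphere times [[-1/2, 0)]. The level [rho = delta] meets it only at time
    [-1/2], on a sphere that shrinks to the centre as [delta -> 0]. *)

Section PartialSums.
Context {R : realType} {n : nat}.
Implicit Types (c : ('I_n -> nat) -> R) (y v : 'I_n -> R).

(* Coefficients of the termwise derivative in the [i]-th variable. *)
Definition sh (i : 'I_n) c : ('I_n -> nat) -> R :=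
  fun a => (a i).+1%:R * c (fun j => a j + (j == i))%N.

Definition dirsh v c : ('I_n -> nat) -> R := fun a => \sum_i v i * sh i c a.

Lemma sh_comm i j c : sh i (sh j c) = sh j (sh i c).
Proof.
apply/funext => a; rewrite /sh.
have -> : (fun k => a k + (k == i) + (k == j))%N =
          (fun k => a k + (k == j) + (k == i))%N.
  by apply/funext => k; rewrite addnAC.
rewrite !mulrA; congr (_ * _); case: (eqVneq i j) => [->//|ij].
by rewrite !addn0 mulrC.
Qed.

(** The index type of [psum] depends on the degree bound, so sums with different bounds can be
    compared termwise only after being moved to a common type. *)
Lemma psum_widen c y (N : nat) (K : nat) : (N <= K)%N ->
  psum c y N = \sum_(a : {ffun 'I_n -> 'I_K.+1} | (\sum_(i < n) (a i : nat) <= N)%N)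
     c (fun i => a i : nat) * monom y (fun i => a i : nat).
Proof.
move=> NK; rewrite /psum.
pose h (a : {ffun 'I_n -> 'I_N.+1}) : {ffun 'I_n -> 'I_K.+1} :=
  [ffun i => inord (a i)].
pose h' (a : {ffun 'I_n -> 'I_K.+1}) : {ffun 'I_n -> 'I_N.+1} :=
  [ffun i => inord (a i)].
have hE a i : (h a i : nat) = a i.
  by rewrite ffunE inordK // (leq_trans (ltn_ord (a i))).
have h'E (a : {ffun 'I_n -> 'I_K.+1}) i :
    (\sum_(i < n) (a i : nat) <= N)%N -> (h' a i : nat) = a i.
  move=> aN; rewrite ffunE inordK // ltnS (leq_trans _ aN) //.
  by rewrite (bigD1 i) //= leq_addr.
rewrite [RHS](reindex_onto h h') /=; last first.
  by move=> a aN; apply/ffunP => i; apply/val_inj; rewrite /= hE h'E.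
apply: eq_big => a.
  have -> : h' (h a) == a.
    apply/eqP/ffunP => i; apply/val_inj => /=.
    by rewrite ffunE hE inordK.
  by rewrite andbT; congr (_ <= _)%N; apply: eq_bigr => i _; rewrite hE.
move=> _; suff -> : (fun i => h a i : nat) = (fun i => a i : nat) by [].
by apply/funext => i; rewrite hE.
Qed.

Lemma psum_homo c y : (forall a, 0 <= c a * monom y a) ->
  {homo psum c y : N K / (N <= K)%N >-> N <= K}.
Proof.
move=> c0 N K NK; rewrite (@psum_widen _ _ _ _ NK) /psum [leRHS](bigID
  (fun a : {ffun 'I_n -> 'I_K.+1} => (\sum_(i < n) (a i : nat) <= N)%N)) /=.
rewrite -[leLHS]addr0 lerD //; last exact: sumr_ge0.
rewrite le_eqVlt; apply/orP; left; apply/eqP/eq_bigl => a.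
by case: (leqP _ N) => [aN|]; rewrite ?andbF // (leq_trans aN).
Qed.

Lemma psum_norm c y N : `|psum c y N| <= psum (fun a => `|c a|) (fun i => `|y i|) N.
Proof.
rewrite (le_trans (ler_norm_sum _ _ _)) // ler_sum // => a _.
by rewrite normrM normr_prod; under eq_bigr do rewrite normrX.
Qed.

Lemma ler_psum c c' y y' N : (forall a, 0 <= c a <= c' a) ->
  (forall i, 0 <= y i <= y' i) -> psum c y N <= psum c' y' N.
Proof.
move=> cc yy; apply: ler_sum => a _.
have m0 z : (forall i, 0 <= z i) -> 0 <= monom z (fun i => a i : nat).
  by move=> z0; apply: prodr_ge0 => i _; rewrite exprn_ge0.
have /andP[c0 c1] := cc (fun i => a i : nat).
rewrite ler_pM //; first by apply: m0 => i; case/andP: (yy i).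
apply: ler_prod => i _; have /andP[y0 y1] := yy i.
by rewrite exprn_ge0 // lerXn2r // nnegrE // (le_trans y0).
Qed.

(** Multi-indices with [a i = 0] drop out through the factor [(a i)%:R], which also makes the
    truncated subtraction harmless; the others correspond to [a - e_i], of degree at most [N]. This
    is why one derivative costs one unit of the degree bound. *)
Lemma psum_shift c y i N :
  \sum_(a : {ffun 'I_n -> 'I_N.+2} | (\sum_(i < n) (a i : nat) <= N.+1)%N)
     c (fun i => a i : nat) * ((a i)%:R * monom y (fun j => a j - (j == i))%N)
  = psum (sh i c) y N.
Proof.
rewrite (bigID (fun a : {ffun 'I_n -> 'I_N.+2} => (a i : nat) == 0)) /=.
rewrite big1 ?add0r => [|a /andP[_ /eqP ->]]; last by rewrite mul0r mulr0.
pose h (a : {ffun 'I_n -> 'I_N.+1}) : {ffun 'I_n -> 'I_N.+2} :=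
  [ffun j => inord (a j + (j == i))].
pose h' (a : {ffun 'I_n -> 'I_N.+2}) : {ffun 'I_n -> 'I_N.+1} :=
  [ffun j => inord (a j - (j == i))].
have hE a j : (h a j : nat) = (a j + (j == i))%N.
  by rewrite ffunE inordK //; have := ltn_ord (a j); case: (j == i); lia.
have h'E (a : {ffun 'I_n -> 'I_N.+2}) j : (\sum_(i < n) (a i : nat) <= N.+1)%N ->
    (a i : nat) != 0 -> (h' a j : nat) = (a j - (j == i))%N.
  move=> aN ai; rewrite ffunE inordK //.
  move: aN; rewrite (bigD1 i) //=; case: (eqVneq j i) => [->|ji].
    by lia.
  by rewrite (bigD1 j) //=; lia.
rewrite (reindex_onto h h') /=; last first.
  move=> a /andP[aN ai]; apply/ffunP => j; apply/val_inj => /=.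
  by rewrite hE h'E //; case: eqP => [->|]; lia.
rewrite /psum; apply: eq_big => a.
  have -> : h' (h a) == a.
    apply/eqP/ffunP => j; apply/val_inj => /=.
    by rewrite ffunE hE addnK inordK.
  rewrite andbT hE eqxx addn1 andbT.
  under eq_bigr do rewrite hE.
  rewrite big_split /= (bigD1 i) //= [in X in (_ + X)%N](bigD1 i) //= eqxx.
  rewrite (big1 _ (fun j => j != i) (fun j => (j == i) : nat)) => [|j /negbTE -> //].
  by rewrite addn0 addn1 -(bigD1 i (P := xpredT)).
move=> _; rewrite /sh mulrA hE eqxx addn1 [_ * _.+1%:R]mulrC.
have -> : (fun j => h a j : nat) = (fun j => a j + (j == i))%N.
  by apply/funext => j; rewrite hE.
suff -> : (fun j => h a j - (j == i))%N = (fun j => a j : nat) by [].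
by apply/funext => j; rewrite hE addnK.
Qed.

Lemma psum0 c N : psum c (fun=> 0) N = c (fun=> 0%N).
Proof.
rewrite /psum (bigD1 [ffun=> ord0]) /=; last first.
  by rewrite big1 // => i _; rewrite ffunE.
have -> : (fun i => ([ffun=> ord0] : {ffun 'I_n -> 'I_N.+1}) i : nat) = (fun=> 0%N).
  by apply/funext => i; rewrite ffunE.
rewrite [monom _ _]big1 => [|i _]; last by rewrite expr0.
rewrite mulr1 big1 ?addr0 // => a /andP[_ a0].
have [i ai] : exists i, (a i : nat) != 0%N.
  apply/existsP; apply: contraT; rewrite negb_exists => /forallP H.
  case/eqP: a0; apply/ffunP => i; apply/val_inj; rewrite /= ffunE /=.
  by apply/eqP; move: (H i); rewrite negbK.
by rewrite /monom (bigD1 i) //= expr0n (negbTE ai) mul0r mulr0.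
Qed.

Lemma psumD c c' y N : psum (fun a => c a + c' a) y N = psum c y N + psum c' y N.
Proof. by rewrite -big_split; apply: eq_bigr => a _; rewrite mulrDl. Qed.

Lemma psumZ (k : R) c y N : psum (fun a => k * c a) y N = k * psum c y N.
Proof. by rewrite mulr_sumr; apply: eq_bigr => a _; rewrite mulrA. Qed.

Lemma psum_dirsh v c y N :
  psum (dirsh v c) y N = \sum_i v i * psum (sh i c) y N.
Proof.
under eq_bigr do rewrite mulr_sumr.
rewrite exchange_big; apply: eq_bigr => a _ /=.
by rewrite /dirsh mulr_suml; apply: eq_bigr => i _; rewrite mulrA.
Qed.

End PartialSums.

Lemma is_derive_prod {R : realType} {V : normedModType R} (I : eqType) (r : seq I)
    (f : I -> V -> R) (x v : V) (df : I -> R) : uniq r ->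
  (forall i, is_derive x v (f i) (df i)) ->
  is_derive x v (fun z => \prod_(i <- r) f i z)
    (\sum_(i <- r) df i * \prod_(j <- r | j != i) f j x).
Proof.
move=> + fd; elim: r => [_|i r IH /= /andP[ir ur]].
  rewrite big_nil; under eq_fun do rewrite big_nil; exact: is_derive_cst.
have H := IH ur.
have -> : (fun z => \prod_(i0 <- (i :: r)) f i0 z) =
    (f i * (fun z => \prod_(i0 <- r) f i0 z)).
  by apply/funext => z; rewrite big_cons.
apply: is_derive_eq; rewrite !big_cons eqxx /= addrC; congr (_ + _).
  rewrite /GRing.scale /= mulrC; congr (_ * _).
  rewrite big_seq [RHS]big_seq_cond; apply: eq_bigl => j.
  by case: (boolP (j \in r)) => // jr; rewrite eq_sym (memPnC ir).
rewrite /GRing.scale /= mulr_sumr !big_seq; apply: eq_bigr => j jr.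
by rewrite big_cons (memPnC ir) // mulrCA.
Qed.

Section LineDerivative.
Context {R : realType} {n : nat}.
Implicit Types (c : ('I_n -> nat) -> R) (y v : 'I_n -> R).

Lemma is_derive_psum c y v (N : nat) (s : R) :
  is_derive s (1 : R) (fun s : R => psum c (fun i => y i + s * v i) N.+1)
    (psum (dirsh v c) (fun i => y i + s * v i) N).
Proof.
have H (a : {ffun 'I_n -> 'I_N.+2}) : is_derive s (1 : R)
   (fun s : R => monom (fun i => y i + s * v i) (fun i => a i : nat))
   (\sum_i v i * ((a i)%:R * monom (fun i => y i + s * v i) (fun j => a j - (j == i))%N)).
  apply: (@is_derive_eq _ _ _ _ _ _ _ _ (@is_derive_prod R R 'I_n (index_enum 'I_n)
    (fun i s => (y i + s * v i) ^+ a i) s 1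
    (fun i => (a i)%:R * (y i + s * v i) ^+ (a i).-1 * v i) (index_enum_uniq _) _)).
    move=> i.
    have H : is_derive s (1 : R) (fun s : R => y i + s * v i) (v i).
      have -> : (fun s : R => y i + s * v i) = cst (y i) + v i \*: (id : R -> R).
        by apply/funext => z; rewrite /= mulrC.
      by apply: is_derive_eq; rewrite add0r /GRing.scale /= mulr1.
    have -> : (fun s : R => (y i + s * v i) ^+ a i) = (fun s : R => y i + s * v i) ^+ a i.
      by apply/funext => z; rewrite exprfctE.
    by apply: is_derive_eq.
  apply: eq_bigr => i _; rewrite mulrAC mulrC; congr (_ * _).
  rewrite -mulrA; congr (_ * _); rewrite /monom (bigD1 i (P := xpredT)) //= eqxx subn1.
  by congr (_ * _); apply: eq_bigr => j /negbTE ->; rewrite subn0.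
rewrite psum_dirsh; under eq_bigr do rewrite -psum_shift mulr_sumr.
rewrite exchange_big /=.
have -> : (fun s : R => psum c (fun i => y i + s * v i) N.+1) =
  (\sum_(a : {ffun 'I_n -> 'I_N.+2} | (\sum_(i < n) (a i : nat) <= N.+1)%N)
     (c (fun i => a i : nat) \*: (fun s : R => monom (fun i => y i + s * v i) (fun i => a i : nat)))).
  by apply/funext => z; rewrite /psum fct_sumE.
elim/big_ind2: _ => [|f f' g g' Hf Hg|a _]; first exact: is_derive_cst.
  by apply: is_derive_eq.
apply: is_derive_eq; rewrite /GRing.scale /= mulr_sumr; apply: eq_bigr => i _.
by rewrite mulrCA.
Qed.

End LineDerivative.

(** * Taylor estimates in one real variable *)

Section OneVariable.
Context {R : realType}.

Lemma mvt_bound (f df : R -> R) (h K : R) :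
  (forall s, `|s| <= `|h| -> is_derive s (1 : R) f (df s)) ->
  (forall s, `|s| <= `|h| -> `|df s| <= K) -> `|f h - f 0| <= K * `|h|.
Proof.
move=> fd bd.
have cf a b : (forall s, s \in `[a, b]%R -> `|s| <= `|h|) ->
    {within `[a, b], continuous f}.
  by move=> ab; apply: derivable_within_continuous => s /ab /fd [].
have [h0|h0] := leP 0 h.
  have hs s : s \in `[0, h]%R -> `|s| <= `|h|.
    by rewrite in_itv /= => /andP[s0 sh]; rewrite !ger0_norm.
  have [|s /hs sh ->] := @MVT_segment _ f df 0 h h0 _ (cf _ _ hs).
    by move=> x /subset_itv_oo_cc /hs; exact: fd.
  by rewrite subr0 normrM ler_wpM2r // bd.
have hs s : s \in `[h, 0]%R -> `|s| <= `|h|.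
  by rewrite in_itv /= => /andP[s0 sh]; rewrite !ler0_norm ?lerN2 ?(ltW h0).
have [|s /hs sh E] := @MVT_segment _ f df h 0 (ltW h0) _ (cf _ _ hs).
  by move=> x /subset_itv_oo_cc /hs; exact: fd.
by rewrite distrC E sub0r normrM normrN ler_wpM2r // bd.
Qed.

(** A quadratic remainder estimate survives the limit of partial sums, so it is the route to
    derivatives of power series. *)
Lemma is_derive_of_bound {V : normedModType R} (f : V -> R) (x v : V) (L K e : R) :
  0 < e ->
  (forall h : R, `|h| < e -> `|f (x + h *: v) - f x - h * L| <= K * h ^+ 2) ->
  is_derive x v f L.
Proof.
move=> e0 H.
have C : (h^-1 *: (f (h *: v + x) - f x)) @[h --> 0^'] --> L.
  apply/cvgrPdist_le => /= eps eps0; near=> h.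
  have h0 : h != 0 by near: h; exact: nbhs_dnbhs_neq.
  have hn : 0 < `|h| by rewrite normr_gt0.
  have hK : `|h| * (`|K| + 1) <= eps.
    rewrite -ler_pdivlMr ?ltr_wpDl //; near: h.
    by apply: dnbhs0_le; rewrite divr_gt0 // ltr_wpDl.
  have he : `|h| < e by near: h; exact: dnbhs0_lt.
  rewrite distrC -(ler_pM2l hn) -normrM.
  have -> : h * (h^-1 *: (f (h *: v + x) - f x) - L) = f (x + h *: v) - f x - h * L.
    by rewrite mulrBr /GRing.scale /= mulrA divff // mul1r addrC [_ + x]addrC; ring.
  apply: le_trans (H _ he) _; rewrite -real_normK ?num_real // expr2.
  rewrite mulrCA ler_pM2l // (le_trans _ hK) // mulrC ler_pM2l //.
  by rewrite (le_trans (ler_norm _)) // lerDl.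
by split; [apply/cvg_ex; exists L | apply: cvg_lim C].
Unshelve. all: by end_near. Qed.

(** Here [f m] plays the role of the [m]-th derivative of [f 0]. Induction on [k]: the mean value
    theorem integrates the estimate for the shifted sequence, and boundedness on the compact
    interval starts it, so the constant stays inexplicit. *)
Lemma deriv_taylor (f : nat -> R -> R) (rho : R) (k : nat) :
  (forall m t, `|t| <= rho -> is_derive t (1 : R) (f m) (f m.+1 t)) ->
  exists C : R, forall t, `|t| <= rho ->
    `|f 0%N t - \sum_(j < k) f j 0 / (j`!)%:R * t ^+ j| <= C * `|t| ^+ k.
Proof.
elim: k f => [|k IH] f fd.
  have [rho0|rho0] := leP 0 rho; last first.
    by exists 0 => t; rewrite leNgt (lt_le_trans rho0).
  have cf : {within `[-rho, rho], continuous (f 0%N)}.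
    apply: derivable_within_continuous => s; rewrite in_itv /= -ler_norml.
    by move=> /(fd 0%N) [].
  have rr : - rho <= rho by lra.
  have [c1 _ H1] := EVT_max rr cf.
  have [c2 _ H2] := EVT_min rr cf.
  exists (`|f 0%N c1| + `|f 0%N c2|) => t; rewrite ler_norml => tr.
  rewrite big_ord0 subr0 expr0 mulr1.
  have t1 := H1 t tr; have t2 := H2 t tr.
  rewrite ler_norml; have := ler_norm (f 0%N c1); have := ler_norm (- f 0%N c2).
  by rewrite normrN; have := normr_ge0 (f 0%N c1); have := normr_ge0 (f 0%N c2); lra.
have [C HC] := IH (fun m => f m.+1) (fun m => fd m.+1).
exists C => t tr.
pose g t := f 0%N t - \sum_(j < k.+1) f j 0 / (j`!)%:R * t ^+ j.
pose dg t := f 1%N t - \sum_(j < k) f j.+1 0 / (j`!)%:R * t ^+ j.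
have g0 : g 0 = 0.
  rewrite /g big_ord_recl /= fact0 divr1 expr0 mulr1 big1 ?addr0 ?subrr //.
  by move=> i _; rewrite expr0n /= mulr0.
have C0 : 0 <= C * `|t| ^+ k by apply: le_trans (HC t tr).
rewrite -/(g t) -[g t]subr0 -g0 exprSr mulrA; apply: (@mvt_bound _ dg).
  move=> s st; have sr := le_trans st tr.
  have -> : g = f 0%N - \sum_(j < k.+1) (f j 0 / (j`!)%:R) \*: ((id : R -> R) ^+ j).
    apply/funext => z; rewrite /g /= fct_sumE; congr (_ - _).
    by apply: eq_bigr => j _; rewrite /= exprfctE.
  have H1 := fd 0%N s sr.
  apply: is_derive_eq; rewrite /dg; congr (_ - _).
  rewrite big_ord_recl /= mul0r scale0r scaler0 add0r; apply: eq_bigr => j _.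
  rewrite /GRing.scale /= mulr1 /bump /= add1n factS natrM.
  have n1 : j.+1%:R != 0 :> R by rewrite pnatr_eq0.
  have n2 : (j`!)%:R != 0 :> R by rewrite pnatr_eq0 -lt0n fact_gt0.
  move: (j.+1%:R : R) ((j`!)%:R : R) n1 n2 => a b n1 n2.
  by rewrite add0n; field; rewrite n1 n2.
move=> s st; have sr := le_trans st tr.
apply: le_trans (HC s sr) _.
(* Enlarging [|s|] to [|t|] in [C * |s| ^ k] needs [C >= 0]. A negative [C] is compatible with the
   estimate only if [t = 0], except at [k = 0], where both sides agree. *)
have [C1|C1] := leP 0 C; first by rewrite ler_wpM2l // lerXn2r // nnegrE.
have := HC s sr; have : C * `|t| ^+ k <= 0 by rewrite mulr_le0_ge0 ?exprn_ge0 // ltW.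
case: k {IH HC g dg g0} C0 => [|k] C0; first by rewrite !expr0.
move=> T0; have /eqP : C * `|t| ^+ k.+1 = 0 by apply/eqP; rewrite eq_le T0.
rewrite mulf_eq0 (lt_eqF C1) /= expf_eq0 /= normr_eq0 => /eqP t0.
by move: st; rewrite t0 normr0 normr_le0 => /eqP -> _; rewrite normr0.
Qed.

(** The leading Taylor term [f k 0 / k! * t ^ k] would dominate [h ^ k.+1] if it were not zero. The
    sign [sg] selects the side of [0] on which the decay is known: the past ([-1]) when it comes
    from the equation, the future ([1]) when equality is already known at later times. *)
Lemma deriv_flat (f : nat -> R -> R) (rho C e : R) (k : nat) (sg : R) :
  0 < rho -> 0 < e -> sg ^+ 2 = 1 ->
  (forall m t, `|t| <= rho -> is_derive t (1 : R) (f m) (f m.+1 t)) ->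
  (forall m, (m < k)%N -> f m 0 = 0) ->
  (forall h : R, 0 < h < e -> `|f 0%N (sg * h)| <= C * h ^+ k.+1) ->
  f k 0 = 0.
Proof.
move=> rho0 e0 sg2 fd f0 fC.
have sg1 : `|sg| = 1.
  by apply/eqP; rewrite -(@eqrXn2 _ 2) // real_normK ?num_real // sg2 expr1n.
have [C' HC] := @deriv_taylor f rho k.+1 fd.
apply/eqP; rewrite -normr_le0; apply/ler_addgt0Pl => eps eps0; rewrite addr0.
pose q : R := (k`!)%:R.
have q0 : 0 < q by rewrite ltr0n fact_gt0.
pose D := `|C| + `|C'| + 1.
have D0 : 0 < D by rewrite /D ltr_wpDl // addr_ge0.
(* The three bounds give access to Taylor's formula, to the decay hypothesis, and to a final error
   of at most [eps]. *)
pose h := Num.min (rho) (Num.min (e / 2) (eps / (D * q))).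
have h0 : 0 < h by rewrite !lt_min rho0 !divr_gt0 // mulr_gt0.
have he : h < e.
  by rewrite (@le_lt_trans _ _ (e / 2)) ?ge_min ?lexx ?orbT //; lra.
have hr : `|sg * h| <= rho.
  by rewrite normrM sg1 mul1r gtr0_norm // ge_min lexx.
have hD : h * (D * q) <= eps.
  by rewrite -ler_pdivlMr ?mulr_gt0 // !ge_min lexx !orbT.
have := HC _ hr; have := fC h; rewrite h0 he => /(_ isT).
rewrite big_ord_recr /= big1 ?add0r => [|j _]; last by rewrite f0 ?mul0r.
rewrite normrM sg1 mul1r (gtr0_norm h0) => H1 H2.
have H3 : `|f k 0 / q * (sg * h) ^+ k| <= (C + C') * h ^+ k.+1.
  rewrite mulrDl; apply: le_trans (lerD H1 H2).
  rewrite (le_trans _ (ler_normB _ _)) // opprB addrC subrK //.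
have hk0 : 0 < h ^+ k by rewrite exprn_gt0.
move: H3; rewrite (normrM (f k 0 / q)) normrX (normrM sg) sg1 mul1r (gtr0_norm h0) exprSr mulrA.
rewrite mulrAC ler_pM2r // normrM normfV (gtr0_norm q0) ler_pdivrMr // => H3.
apply: le_trans H3 (le_trans _ hD).
have -> : (C + C') * h * q = h * ((C + C') * q) by ring.
rewrite ler_pM2l // ler_wpM2r ?(ltW q0) // /D -[C + C']addr0 lerD // lerD //; exact: ler_norm.
Qed.

End OneVariable.

Lemma cvgn_le {R : realType} (u : nat -> R) (l M : R) (k : nat) :
  u N @[N --> \oo] --> l -> (forall N, (k <= N)%N -> u N <= M) -> l <= M.
Proof.
move=> ul uM; rewrite -(cvg_lim (@Rhausdorff R) ul); apply: limr_le.
  by apply/cvg_ex; exists l.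
by exists k.
Qed.

Lemma cvgnS {R : realType} (u : nat -> R) (l : R) :
  u N @[N --> \oo] --> l -> u N.+1 @[N --> \oo] --> l.
Proof. by move=> ul; rewrite (cvg_shiftS u). Qed.

(** * Convergence, differentiation and rescaling of power series *)

Section PowerSeries.
Context {R : realType} {n : nat}.
Implicit Types (c : ('I_n -> nat) -> R) (y v : 'I_n -> R) (r rho : R).

(** Testing at the diagonal points [(rho, ..., rho)] suffices, since they dominate every point of
    the open polydisc of radius [r]. *)
Definition absconv c r := forall rho, 0 <= rho -> rho < r ->
  exists M, forall N, psum (fun a => `|c a|) (fun=> rho) N <= M.

Definition pwsum c y : R := limn (psum c y).

Lemma polydisc_bound r y : 0 < r -> (forall i, `|y i| < r) ->
  exists rho, [/\ 0 <= rho, rho < r & forall i, `|y i| <= rho].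
Proof.
move=> r0 yr; exists (\big[Order.max/0]_i `|y i|); split.
- exact: bigmax_ge_id.
- exact/bigmax_ltP.
- by move=> i; apply: le_bigmax.
Qed.

Lemma monom_cst (x : R) (a : 'I_n -> nat) : monom (fun=> x) a = x ^+ (\sum_i a i).
Proof. by rewrite /monom expr_sum. Qed.

Lemma psum_bound c y rho N : (forall i, `|y i| <= rho) ->
  `|psum c y N| <= psum (fun a => `|c a|) (fun=> rho) N.
Proof.
move=> yr; apply: le_trans (psum_norm c y N) _; apply: ler_psum => [a|i].
  by rewrite normr_ge0 lexx.
by rewrite normr_ge0 yr.
Qed.

(** The monomials are absorbed into the coefficients [A], and [A = (A + |A|) - |A|] turns the
    partial sums into a difference of two bounded nondecreasing sequences. *)
Lemma psum_cvg c r y : 0 < r -> absconv c r -> (forall i, `|y i| < r) ->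
  cvgn (psum c y).
Proof.
move=> r0 ca yr; have [rho [rho0 rhor yrho]] := polydisc_bound r0 yr.
have [M HM] := ca _ rho0 rhor.
pose A (a : 'I_n -> nat) := c a * monom y a.
have E (B : ('I_n -> nat) -> R) : forall N, psum B (fun=> 1) N =
    \sum_(a : {ffun 'I_n -> 'I_N.+1} | (\sum_(i < n) (a i : nat) <= N)%N)
     B (fun i => a i : nat).
  by move=> N; apply: eq_bigr => a _; rewrite monom_cst expr1n mulr1.
have m1 (a : 'I_n -> nat) : monom (fun=> 1) a = 1 :> R.
  by rewrite monom_cst expr1n.
have AM N : psum (fun a => `|A a|) (fun=> 1) N <= M.
  apply: le_trans (HM N); rewrite E; apply: ler_sum => a _.
  rewrite normrM ler_wpM2l // /monom normr_prod; apply: ler_prod => i _.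
  by rewrite normr_ge0 normrX lerXn2r // nnegrE.
have -> : psum c y = (fun N => psum (fun a => A a + `|A a|) (fun=> 1) N
   - psum (fun a => `|A a|) (fun=> 1) N).
  by apply/funext => N; rewrite psumD addrK E.
apply: is_cvgB; apply: nondecreasing_is_cvgn.
- apply: psum_homo => a; rewrite m1 mulr1 addrC -[X in _ + X]opprK subr_ge0 -normrN.
  exact: ler_norm.
- exists (M + M) => _ [N _ <-]; rewrite psumD lerD //; apply: le_trans (AM N).
  by rewrite !E ler_sum // => a _; exact: ler_norm.
- by apply: psum_homo => a; rewrite m1 mulr1.
- by exists M => _ [N _ <-].
Qed.

Lemma pwsum_cvg c r y : 0 < r -> absconv c r -> (forall i, `|y i| < r) ->
  psum c y N @[N --> \oo] --> pwsum c y.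
Proof. by move=> r0 ca yr; exact: (psum_cvg r0 ca yr). Qed.

Lemma pwsum_bound c r rho : absconv c r -> 0 <= rho -> rho < r ->
  exists2 M : R, 0 <= M & forall y, (forall i, `|y i| <= rho) ->
    (forall N, `|psum c y N| <= M) /\ `|pwsum c y| <= M.
Proof.
move=> ca rho0 rhor; have [M HM] := ca _ rho0 rhor.
have pM y : (forall i, `|y i| <= rho) -> forall N, `|psum c y N| <= M.
  by move=> yrho N; apply: le_trans (HM N); exact: psum_bound.
exists M => [|y yrho].
  apply: le_trans (pM (fun=> 0) _ 0%N); first exact: normr_ge0.
  by move=> i; rewrite normr0.
split; first exact: pM.
have r0 : 0 < r by exact: le_lt_trans rhor.
have cv : psum c y N @[N --> \oo] --> pwsum c y.
  by apply: (pwsum_cvg r0 ca) => i; exact: le_lt_trans rhor.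
by apply: (@cvgn_le _ _ _ _ 0%N (cvg_norm cv)) => N _; exact: pM.
Qed.

Lemma dirsh_delta i c : dirsh (fun j => (j == i)%:R) c = sh i c.
Proof.
apply/funext => a; rewrite /dirsh (bigD1 i) //= eqxx mul1r big1 ?addr0 //.
by move=> j /negbTE ->; rewrite mul0r.
Qed.

Lemma absconvD c c' r : absconv c r -> absconv c' r -> absconv (fun a => c a + c' a) r.
Proof.
move=> h h' rho rho0 rhor; have [M HM] := h _ rho0 rhor.
have [M' HM'] := h' _ rho0 rhor; exists (M + M') => N.
apply: le_trans (lerD (HM N) (HM' N)); rewrite -psumD; apply: ler_psum => a.
  by rewrite normr_ge0 ler_normD.
by rewrite rho0 lexx.
Qed.

Lemma absconvZ c r (k : R) : absconv c r -> absconv (fun a => k * c a) r.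
Proof.
move=> h rho rho0 rhor; have [M HM] := h _ rho0 rhor.
exists (`|k| * M) => N; apply: le_trans (ler_wpM2l (normr_ge0 k) (HM N)).
by rewrite -psumZ; under eq_fun do rewrite normrM.
Qed.

Lemma absconv0 r : absconv (fun=> 0) r.
Proof.
by move=> rho _ _; exists 0 => N; rewrite /psum big1 // => a _; rewrite normr0 mul0r.
Qed.

Lemma absconv_sum (I : finType) (c : I -> ('I_n -> nat) -> R) r :
  (forall i, absconv (c i) r) -> absconv (fun a => \sum_i c i a) r.
Proof.
move=> H; elim: (index_enum I) => [|i s IH].
  by under eq_fun do rewrite big_nil; exact: absconv0.
by under eq_fun do rewrite big_cons; exact: absconvD.
Qed.

(* A polynomial with nonnegative coefficients is convex in each variable on the
   positive orthant, so its derivative is dominated by a difference quotient. *)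
Lemma absconv_sh i c r : absconv c r -> absconv (sh i c) r.
Proof.
move=> ca rho rho0 rhor; pose h := (r - rho) / 2.
have h0 : 0 < h by rewrite /h; lra.
have [M HM] := ca (rho + h) (addr_ge0 rho0 (ltW h0)) ltac:(rewrite /h; lra).
exists (M / h) => N; rewrite ler_pdivlMr //.
pose ca' a := `|c a|; pose e j : R := (j == i)%:R.
have -> : (fun a => `|sh i c a|) = sh i ca'.
  by apply/funext => a; rewrite /sh normrM normr_nat.
pose g s := psum ca' (fun j => rho + s * e j) N.+1.
pose dg s := psum (sh i ca') (fun j => rho + s * e j) N.
have gd (s : R) : is_derive s (1 : R) g (dg s).
  by rewrite /dg -(dirsh_delta i); exact: is_derive_psum.
have gc : {within `[0, h], continuous g}.
  by apply: derivable_within_continuous => s _; have [] := gd s.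
have [s] := MVT_segment (ltW h0) (fun s _ => gd s) gc.
rewrite in_itv /= subr0 => /andP[s0 _] E.
have e0 j : 0 <= e j <= 1 by rewrite /e; case: (_ == _); rewrite lexx ler01.
have dle : psum (sh i ca') (fun=> rho) N <= dg s.
  apply: ler_psum => [a|j].
    by rewrite lexx andbT /sh mulr_ge0 // normr_ge0.
  by rewrite rho0 lerDl mulr_ge0 //; case/andP: (e0 j).
apply: le_trans (ler_wpM2r (ltW h0) dle) _; rewrite -E.
apply: le_trans (HM N.+1).
have gh : g h <= psum ca' (fun=> rho + h) N.+1.
  apply: ler_psum => [a|j]; first by rewrite lexx andbT normr_ge0.
  case/andP: (e0 j) => e1 e2.
  apply/andP; split; first by rewrite addr_ge0 // mulr_ge0 // ltW.
  by rewrite lerD2l ler_piMr // ltW.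
apply: le_trans gh; rewrite lerBlDr lerDl; apply: sumr_ge0 => a _.
rewrite mulr_ge0 // ?normr_ge0 //; apply: prodr_ge0 => j _.
by rewrite mul0r addr0 exprn_ge0.
Qed.

Lemma absconv_dirsh v c r : absconv c r -> absconv (dirsh v c) r.
Proof.
by move=> ca; apply: absconv_sum => i; apply: absconvZ; exact: absconv_sh.
Qed.

(** For partial sums, two applications of the mean value bound control the remainder by the second
    directional derivative, with [K] independent of [N]; the estimate then passes to the limit. This
    avoids any exchange of limit and derivative. *)
Lemma pwsum_quad c r v y : 0 < r -> absconv c r -> (forall i, `|y i| < r) ->
  exists K e : R, 0 < e /\ forall h : R, `|h| < e ->
    `|pwsum c (fun i => y i + h * v i) - pwsum c y - h * pwsum (dirsh v c) y|
      <= K * h ^+ 2.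
Proof.
move=> r0 ca yr; have [rho [rho0 rhor yrho]] := polydisc_bound r0 yr.
have cd := absconv_dirsh v ca; have cdd := absconv_dirsh v cd.
pose rho' := (rho + r) / 2.
have r1 : rho < rho' by rewrite /rho'; lra.
have r2 : rho' < r by rewrite /rho'; lra.
have [K K0 HK] := pwsum_bound cdd (le_trans rho0 (ltW r1)) r2.
pose V := \sum_i `|v i| + 1.
have V0 : 0 < V by rewrite ltr_wpDl // sumr_ge0.
exists K, ((rho' - rho) / V); split; first by rewrite divr_gt0 // subr_gt0.
move=> h; rewrite ltr_pdivlMr // => hV.
have yh s : `|s| <= `|h| -> forall i, `|y i + s * v i| <= rho'.
  move=> sleh i; apply: le_trans (ler_normD _ _) _; rewrite -[rho'](subrK rho) addrC.
  rewrite lerD // (le_trans _ (ltW hV)) // normrM ler_pM //.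
  by rewrite /V (bigD1 i) //= -addrA lerDl addr_ge0 // sumr_ge0.
have P N : `|psum c (fun i => y i + h * v i) N.+2 - psum c y N.+2
     - h * psum (dirsh v c) y N.+1| <= K * h ^+ 2.
  pose f s := psum c (fun i => y i + s * v i) N.+2.
  pose f1 s := psum (dirsh v c) (fun i => y i + s * v i) N.+1.
  pose f2 s := psum (dirsh v (dirsh v c)) (fun i => y i + s * v i) N.
  have d1 (s : R) : is_derive s (1 : R) f (f1 s) by exact: is_derive_psum.
  have d2 (s : R) : is_derive s (1 : R) f1 (f2 s) by exact: is_derive_psum.
  have y0 : (fun i => y i + 0 * v i) = y.
    by apply/funext => i; rewrite mul0r addr0.
  have b1 s : `|s| <= `|h| -> `|f1 s - f1 0| <= K * `|h|.
    move=> sleh; apply: le_trans (@mvt_bound _ f1 f2 s K _ _) _ => //.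
      by move=> s' s's; apply: (HK _ _).1; apply: yh; exact: le_trans sleh.
    by rewrite ler_wpM2l.
  pose g s := f s - s * f1 0.
  have gd (s : R) : is_derive s (1 : R) g (f1 s - f1 0).
    have -> : g = f - (f1 0) \*: (id : R -> R).
      by apply/funext => z; rewrite /g /= mulrC.
    by have := d1 s => ?; apply: is_derive_eq; rewrite /GRing.scale /= mulr1.
  have := @mvt_bound _ g (fun s => f1 s - f1 0) h (K * `|h|) (fun s _ => gd s) b1.
  rewrite /g mul0r subr0 /f1 /f y0 -mulrA -expr2 real_normK ?num_real //.
  by rewrite addrAC.
have c1 : psum c (fun i => y i + h * v i) N @[N --> \oo] -->
    pwsum c (fun i => y i + h * v i).
  by apply: (pwsum_cvg r0 ca) => i; apply: le_lt_trans r2; exact: yh.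
have c2 := pwsum_cvg r0 ca yr; have c3 := pwsum_cvg r0 cd yr.
have C : `|psum c (fun i => y i + h * v i) N.+2 - psum c y N.+2
     - h * psum (dirsh v c) y N.+1| @[N --> \oo] -->
  `|pwsum c (fun i => y i + h * v i) - pwsum c y - h * pwsum (dirsh v c) y|.
  apply: cvg_norm; apply: cvgB; last first.
    by apply: cvgMr; exact: (cvgnS c3).
  by apply: cvgB; [exact: (cvgnS (cvgnS c1))|exact: (cvgnS (cvgnS c2))].
by apply: (@cvgn_le _ _ _ _ 0%N C) => N _; exact: P.
Qed.

Lemma is_derive_pwsum c r v y (s : R) : 0 < r -> absconv c r ->
  (forall i, `|y i + s * v i| < r) ->
  is_derive s (1 : R) (fun s : R => pwsum c (fun i => y i + s * v i))
    (pwsum (dirsh v c) (fun i => y i + s * v i)).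
Proof.
move=> r0 ca yr; have [K [e [e0 He]]] := pwsum_quad v r0 ca yr.
apply: (@is_derive_of_bound _ _ _ _ _ _ K e e0) => h he.
have -> : (fun i => y i + (s + h *: 1) * v i) = (fun i => y i + s * v i + h * v i).
  by apply/funext => i; rewrite /GRing.scale /= mulr1 mulrDl addrA.
exact: He.
Qed.

Lemma pwsumB c c' r y : 0 < r -> absconv c r -> absconv c' r -> (forall i, `|y i| < r) ->
  pwsum (fun a => c a - c' a) y = pwsum c y - pwsum c' y.
Proof.
move=> r0 ca ca' yr; apply: cvg_lim; first exact: Rhausdorff.
have -> : psum (fun a => c a - c' a) y = (fun N => psum c y N - psum c' y N).
  apply/funext => N; rewrite -[- psum c' y N]mulN1r -psumZ -psumD.
  by congr psum; apply/funext => a; rewrite mulN1r.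
by apply: cvgB; [exact: (pwsum_cvg r0 ca yr)|exact: (pwsum_cvg r0 ca' yr)].
Qed.

(** These are the coefficients of [y |-> k * f (D y)], where [f] has coefficients [c] and [D] acts
    diagonally. *)
Definition scalcoef (D : 'I_n -> R) (k : R) c : ('I_n -> nat) -> R :=
  fun a => k * (monom D a * c a).

Lemma psum_scal D k c y N :
  psum (scalcoef D k c) y N = k * psum c (fun i => D i * y i) N.
Proof.
rewrite /psum mulr_sumr; apply: eq_bigr => a _.
rewrite /scalcoef -!mulrA; congr (_ * _); rewrite mulrCA; congr (_ * _).
by rewrite /monom -big_split; apply: eq_bigr => i _; rewrite exprMn.
Qed.

Lemma absconv_scal D k c r : (forall i, 0 <= D i <= 1) -> absconv c r ->
  absconv (scalcoef D k c) r.
Proof.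
move=> D01 ca; apply: absconvZ => rho rho0 rhor; have [M HM] := ca _ rho0 rhor.
exists M => N; apply: le_trans (HM N); apply: ler_psum => [a|i]; last by rewrite rho0 lexx.
rewrite normr_ge0 normrM ler_piMl //= ger0_norm.
  by apply: prodr_ile1 => i _; have /andP[D0 D1] := D01 i; rewrite exprn_ge0 // exprn_ile1.
by apply: prodr_ge0 => i _; have /andP[D0 D1] := D01 i; rewrite exprn_ge0.
Qed.

Lemma pwsum_scal D k c r y : 0 < r -> absconv c r -> (forall i, `|D i * y i| < r) ->
  pwsum (scalcoef D k c) y = k * pwsum c (fun i => D i * y i).
Proof.
move=> r0 ca yr; apply: cvg_lim; first exact: Rhausdorff.
rewrite (_ : psum _ y = fun N => k * psum c (fun i => D i * y i) N); last first.
  by apply/funext => N; exact: psum_scal.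
by apply: cvgMr; exact: (pwsum_cvg r0 ca yr).
Qed.

Lemma sh_scal D k c i : sh i (scalcoef D k c) = scalcoef D (k * D i) (sh i c).
Proof.
apply/funext => a; rewrite /sh /scalcoef.
have -> : monom D (fun j => a j + (j == i))%N = monom D a * D i.
  rewrite /monom (bigD1 i) //= [in RHS](bigD1 i) //= eqxx exprD expr1.
  rewrite [X in _ * X](eq_bigr (fun j => D j ^+ a j)); first by ring.
  by move=> j /negbTE ->; rewrite addn0.
by ring.
Qed.

Lemma iter_sh_comm m i j c : iter m (sh i) (sh j c) = sh j (iter m (sh i) c).
Proof. by elim: m => //= m ->; rewrite sh_comm. Qed.

Lemma absconv_iter_sh m i c r : absconv c r -> absconv (iter m (sh i) c) r.
Proof. by move=> ca; elim: m => //= m; exact: absconv_sh. Qed.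

(** The factor is [(a i + 1) ... (a i + m)]; only its nonvanishing matters, to recover coefficients
    from derivatives. *)
Lemma iter_shE m i c a : exists2 k : R, k != 0 &
  iter m (sh i) c a = k * c (fun j => a j + m * (j == i))%N.
Proof.
elim: m a => [|m IH] a.
  exists 1; rewrite ?oner_eq0 // mul1r /=; congr c.
  by apply/funext => j; rewrite mul0n addn0.
have [k k0 E] := IH (fun j => a j + (j == i))%N.
exists ((a i).+1%:R * k); first by rewrite mulf_neq0 // pnatr_eq0.
rewrite /= {1}/sh E -mulrA; congr (_ * (_ * c _)).
by apply/funext => j; rewrite mulSn addnA.
Qed.

(** On the [i]-axis only pure powers of [y i] survive, and by [iter_shE] their coefficients vanish
    together with the iterated derivatives at [0]. *)
Lemma psum_axis c y i N : (forall m, iter m (sh i) c (fun=> 0%N) = 0) ->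
  (forall j, j != i -> y j = 0) -> psum c y N = 0.
Proof.
move=> c0 y0; apply: big1 => a _.
have [/existsP[j /andP[ji aj]]|/existsPn H] := boolP [exists j, (j != i) && ((a j : nat) != 0%N)].
  by rewrite /monom (bigD1 j) //= y0 // expr0n (negbTE aj) mul0r mulr0.
have [k k0] := iter_shE (a i) i c (fun=> 0%N); rewrite c0 => /esym/eqP.
rewrite mulf_eq0 (negbTE k0) /= => /eqP E; rewrite (_ : (fun j => a j : nat) =
  (fun j => 0 + a i * (j == i))%N) ?E ?mul0r //.
apply/funext => j; rewrite add0n; have [->|ji] := eqVneq j i; first by rewrite muln1.
by rewrite muln0; apply/eqP; move: (H j); rewrite ji /= negbK.
Qed.

Lemma pwsum_axis c y i : (forall m, iter m (sh i) c (fun=> 0%N) = 0) ->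
  (forall j, j != i -> y j = 0) -> pwsum c y = 0.
Proof.
move=> c0 y0; rewrite /pwsum (_ : psum c y = fun=> 0); first exact: lim_cst.
by apply/funext => N; exact: psum_axis c0 y0.
Qed.

(** Mean value theorem along the segment from [z] to [y], which stays in the convex polydisc, with
    constants that are the same for all partial sums. *)
Lemma pwsum_lip c r rho : absconv c r -> 0 <= rho -> rho < r ->
  exists2 K : R, 0 <= K & forall y z, (forall i, `|y i| <= rho) ->
    (forall i, `|z i| <= rho) ->
    `|pwsum c y - pwsum c z| <= K * \sum_i `|y i - z i|.
Proof.
move=> ca rho0 rhor; have r0 : 0 < r by exact: le_lt_trans rhor.
have /choice[K HK] (i : 'I_n) : exists K, 0 <= K /\ forall y, (forall i, `|y i| <= rho) ->
    forall N, `|psum (sh i c) y N| <= K.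
  have [K K0 HK] := pwsum_bound (absconv_sh i ca) rho0 rhor.
  by exists K; split=> // y /HK[].
exists (\sum_i K i) => [|y z yr zr]; first by apply: sumr_ge0 => i _; case: (HK i).
have P N : `|psum c y N.+1 - psum c z N.+1| <= (\sum_i K i) * \sum_i `|y i - z i|.
  pose v i := y i - z i.
  pose f s := psum c (fun i => z i + s * v i) N.+1.
  have d1 (s : R) : is_derive s (1 : R) f (psum (dirsh v c) (fun i => z i + s * v i) N).
    exact: is_derive_psum.
  have cf : {within `[0, 1], continuous f}.
    by apply: derivable_within_continuous => s _; have [] := d1 s.
  have -> : psum c y N.+1 = f 1.
    by congr (psum c _ _); apply/funext => i; rewrite mul1r addrC subrK.
  have -> : psum c z N.+1 = f 0.
    by congr (psum c _ _); apply/funext => i; rewrite mul0r addr0.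
  have [s] := MVT_segment ler01 (fun s _ => d1 s) cf.
  rewrite in_itv /= subr0 mulr1 => /andP[s0 s1] ->.
  rewrite psum_dirsh (le_trans (ler_norm_sum _ _ _)) // mulr_sumr ler_sum // => i _.
  rewrite normrM mulrC ler_wpM2r //.
  apply: (@le_trans _ _ (K i)); last first.
    by rewrite (bigD1 i) //= lerDl sumr_ge0 // => j _; case: (HK j).
  apply: (HK i).2 => j.
  have -> : z j + s * v j = (1 - s) * z j + s * y j by rewrite /v; ring.
  apply: le_trans (ler_normD _ _) _.
  rewrite !normrM (ger0_norm s0) (@ger0_norm _ (1 - s)) ?subr_ge0 //.
  have -> : rho = (1 - s) * rho + s * rho by ring.
  by rewrite lerD // ler_wpM2l // subr_ge0.
have c1 : psum c y N @[N --> \oo] --> pwsum c y.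
  by apply: (pwsum_cvg r0 ca) => i; exact: le_lt_trans rhor.
have c2 : psum c z N @[N --> \oo] --> pwsum c z.
  by apply: (pwsum_cvg r0 ca) => i; exact: le_lt_trans rhor.
have C : `|psum c y N.+1 - psum c z N.+1| @[N --> \oo] --> `|pwsum c y - pwsum c z|.
  by apply: cvg_norm; apply: cvgB; [exact: (cvgnS c1)|exact: (cvgnS c2)].
by apply: (@cvgn_le _ _ _ _ 0%N C) => N _; exact: P.
Qed.

(** A monomial of degree above [k] is at most [(m / rho) ^ k.+1] times its value at the diagonal
    point [rho], so the tail is controlled by the bounded sums there. *)
Lemma pwsum_tail c r rho (k : nat) : absconv c r -> 0 < rho -> rho < r ->
  exists2 C : R, 0 <= C & forall y m, m <= rho -> (forall i, `|y i| <= m) -> 0 <= m ->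
    `|pwsum c y - psum c y k| <= C * m ^+ k.+1.
Proof.
move=> ca rho0 rhor; have r0 : 0 < r by exact: lt_trans rhor.
have [M HM] := ca _ (ltW rho0) rhor.
have M0 : 0 <= M by apply: le_trans (HM 0%N); apply: sumr_ge0 => a _;
  rewrite mulr_ge0 // ?normr_ge0 // monom_cst exprn_ge0 // ltW.
exists (M / rho ^+ k.+1) => [|y m mr ym m0]; first by rewrite divr_ge0 // exprn_ge0 // ltW.
have P N : (k <= N)%N -> `|psum c y N - psum c y k| <= M / rho ^+ k.+1 * m ^+ k.+1.
  move=> kN; rewrite (@psum_widen _ _ c y k N kN) [psum c y N](bigID
    (fun a : {ffun 'I_n -> 'I_N.+1} => (\sum_(i < n) (a i : nat) <= k)%N)) /=.
  rewrite [X in _ + _ - X](eq_bigl (fun a : {ffun 'I_n -> 'I_N.+1} =>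
    (\sum_(i < n) (a i : nat) <= N)%N && (\sum_(i < n) (a i : nat) <= k)%N)); last first.
    by move=> a; case: (leqP _ k) => [ak|]; rewrite ?andbF // (leq_trans ak).
  rewrite addrAC subrr add0r (le_trans (ler_norm_sum _ _ _)) //.
  have -> : M / rho ^+ k.+1 * m ^+ k.+1 = M * (m / rho) ^+ k.+1.
    by rewrite expr_div_n mulrAC mulrA.
  apply: le_trans (ler_wpM2r _ (HM N)); last by rewrite exprn_ge0 // divr_ge0 // ltW.
  rewrite /psum mulr_suml [leRHS](bigID
    (fun a : {ffun 'I_n -> 'I_N.+1} => (\sum_(i < n) (a i : nat) <= k)%N)) /=.
  rewrite -[leLHS]add0r lerD //.
    apply: sumr_ge0 => a _; rewrite mulr_ge0 //.
      by rewrite mulr_ge0 // monom_cst exprn_ge0 // ltW.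
    by rewrite exprn_ge0 // divr_ge0 // ltW.
  apply: ler_sum => a /andP[_]; rewrite -ltnNge => ak.
  rewrite normrM -mulrA ler_wpM2l // monom_cst.
  apply: (@le_trans _ _ (m ^+ \sum_i (a i : nat))).
    rewrite expr_sum /monom normr_prod; apply: ler_prod => i _.
    by rewrite normr_ge0 normrX lerXn2r // nnegrE.
  rewrite -(subnK ak) !exprD -mulrA -exprMn mulrC mulrC [rho * _]mulrC divfK ?gt_eqF //.
  by rewrite ler_wpM2r ?exprn_ge0 // lerXn2r // nnegrE // ltW.
have c1 : psum c y N @[N --> \oo] --> pwsum c y.
  apply: (pwsum_cvg r0 ca) => i; apply: le_lt_trans rhor; exact: le_trans (ym i) mr.
have C : `|psum c y N - psum c y k| @[N --> \oo] --> `|pwsum c y - psum c y k|.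
  by apply: cvg_norm; apply: cvgB => //; exact: cvg_cst.
exact: cvgn_le C P.
Qed.

Lemma pwsum0 c : pwsum c (fun=> 0) = c (fun=> 0%N).
Proof.
rewrite /pwsum (_ : psum c _ = fun=> c (fun=> 0%N)); first exact: lim_cst.
by apply/funext => N; rewrite psum0.
Qed.

End PowerSeries.

(** * Functions of time and space given by power series *)

Section Coordinates.
Context {R : realType} {d : nat}.
Implicit Types (p q : R * 'rV[R]_d) (f u : R -> 'rV[R]_d -> R).

Definition dcoords p q : 'I_d.+1 -> R := fun i => coords q i - coords p i.

Definition xi (j : 'I_d) : 'I_d.+1 := lift ord0 j.

Lemma coords_t (t : R) (x : 'rV[R]_d) : coords (t, x) ord0 = t.
Proof. by rewrite /coords unlift_none. Qed.

Lemma coords_x (t : R) (x : 'rV[R]_d) j : coords (t, x) (xi j) = x 0 j.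
Proof. by rewrite /coords liftK. Qed.

Lemma coordsP (P : 'I_d.+1 -> Prop) : P ord0 -> (forall j, P (xi j)) -> forall i, P i.
Proof. by move=> P0 PS i; case: (unliftP ord0 i) => [j ->|->]. Qed.

Lemma dcoords_t p q : dcoords p q ord0 = q.1 - p.1.
Proof. by case: p q => ? ? [? ?]; rewrite /dcoords !coords_t. Qed.

Lemma dcoords_x p q j : dcoords p q (xi j) = q.2 0 j - p.2 0 j.
Proof. by case: p q => ? ? [? ?]; rewrite /dcoords !coords_x. Qed.

Lemma dcoords_line p q (a s : R) (v : 'rV[R]_d) :
  dcoords p (q.1 + s * a, q.2 + s *: v) = fun i => dcoords p q i + s * coords (a, v) i.
Proof.
apply/funext; apply: coordsP => [|j].
  by rewrite !dcoords_t coords_t /=; ring.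
by rewrite !dcoords_x coords_x /= !mxE; ring.
Qed.

Lemma dcoords_id p : dcoords p p = fun=> 0.
Proof. by apply/funext => i; rewrite /dcoords subrr. Qed.

Lemma dirsh_t c : dirsh (coords ((1 : R), (0 : 'rV[R]_d))) c = sh ord0 c.
Proof.
rewrite -dirsh_delta; congr (dirsh _ c); apply/funext.
by apply: coordsP => [|j]; rewrite ?coords_t ?coords_x ?eqxx // mxE.
Qed.

Lemma dirsh_x c j : dirsh (coords ((0 : R), evec j)) c = sh (xi j) c.
Proof.
rewrite -dirsh_delta; congr (dirsh _ c); apply/funext.
apply: coordsP => [|k]; rewrite ?coords_t ?coords_x //.
by rewrite mxE eqxx /xi (inj_eq lift_inj).
Qed.

Lemma polydisc_line (n : nat) (y v : 'I_n -> R) (r : R) : 0 < r ->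
  (forall i, `|y i| < r) ->
  exists2 e : R, 0 < e & forall h : R, `|h| < e -> forall i, `|y i + h * v i| < r.
Proof.
move=> r0 yr; have [rho [rho0 rhor yrho]] := polydisc_bound r0 yr.
pose V := \sum_i `|v i| + 1.
have V0 : 0 < V by rewrite ltr_wpDl // sumr_ge0.
exists ((r - rho) / V) => [|h]; first by rewrite divr_gt0 // subr_gt0.
rewrite ltr_pdivlMr // => hV i; apply: le_lt_trans (ler_normD _ _) _.
rewrite -[r](subrK rho) addrC ltr_leD // (le_lt_trans _ hV) // normrM ler_wpM2l //.
by rewrite /V (bigD1 i) //= -addrA lerDl addr_ge0 // sumr_ge0.
Qed.

Lemma polydisc_nbhs p (e : R) : 0 < e ->
  \forall q \near p, forall i, `|dcoords p q i| < e.
Proof.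
move=> e0; have := nbhsx_ballx p e e0; apply: filterS => q [/= b1 b2].
apply: coordsP => [|j]; first by rewrite dcoords_t distrC.
by rewrite dcoords_x distrC; have [_ /(_ 0 j)] := b2.
Qed.

(* The restriction to negative times makes the notion stable under [pdt] also at
   the points of the terminal slice, where [u] is only known for [t <= 0]. *)
Definition psrepr f p (r : R) c := [/\ 0 < r, absconv c r &
  forall q, (forall i, `|dcoords p q i| < r) -> q.1 < 0 ->
    f q.1 q.2 = pwsum c (dcoords p q)].

Lemma psrepr_is_derive_t f p r c q : psrepr f p r c ->
  (forall i, `|dcoords p q i| < r) -> q.1 < 0 ->
  is_derive q.1 (1 : R) (fun s => f s q.2) (pwsum (sh ord0 c) (dcoords p q)).
Proof.
move=> [r0 ca fE] qr q0.
have [K [e [e0 He]]] := pwsum_quad (coords (1, 0 : 'rV[R]_d)) r0 ca qr.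
have [e' e'0 He'] := polydisc_line (coords (1, 0 : 'rV[R]_d)) r0 qr.
(* The increment also stays below [- q.1]: the derivative is two-sided, but the representation holds
   only at negative times. *)
apply: (@is_derive_of_bound _ _ _ _ _ _ K (Num.min e (Num.min e' (- q.1)))).
  by rewrite !lt_min e0 e'0 oppr_gt0.
move=> h; rewrite !lt_min => /and3P[h1 h2 h3].
have E : q.1 + h *: 1 = q.1 + h * 1 by [].
have q0' : q.1 + h * 1 < 0.
  by move: (ler_norm h); rewrite mulr1; lra.
have /= := fE (q.1 + h * 1, q.2 + h *: 0); rewrite dcoords_line /= scaler0 addr0 => H.
rewrite E H //; last exact: He'.
rewrite fE // -dirsh_t; exact: He.
Qed.

Lemma psrepr_is_derive_x f p r c q v : psrepr f p r c ->
  (forall i, `|dcoords p q i| < r) -> q.1 < 0 ->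
  is_derive q.2 v (f q.1) (pwsum (dirsh (coords (0, v)) c) (dcoords p q)).
Proof.
move=> [r0 ca fE] qr q0.
have [K [e [e0 He]]] := pwsum_quad (coords (0, v)) r0 ca qr.
have [e' e'0 He'] := polydisc_line (coords (0, v)) r0 qr.
apply: (@is_derive_of_bound _ _ _ _ _ _ K (Num.min e e')).
  by rewrite !lt_min e0.
move=> h; rewrite !lt_min => /andP[h1 h2].
have := fE (q.1 + h * 0, q.2 + h *: v); rewrite dcoords_line /= mulr0 addr0 => ->//; last exact: He'.
rewrite fE //; exact: He.
Qed.

Lemma psrepr_pdt f p r c : psrepr f p r c -> psrepr (pdt f) p r (sh ord0 c).
Proof.
move=> rf; have [r0 ca _] := rf; split=> //; first exact: absconv_sh.
by move=> q qr q0; have [_ ] := psrepr_is_derive_t rf qr q0.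
Qed.

Lemma psrepr_pdx f p r c j : psrepr f p r c -> psrepr (pdx j f) p r (sh (xi j) c).
Proof.
move=> rf; have [r0 ca _] := rf; split=> //; first exact: absconv_sh.
by move=> q qr q0; have [_ ] := psrepr_is_derive_x (evec j) rf qr q0; rewrite dirsh_x.
Qed.

Lemma psrepr_center f p r c : psrepr f p r c -> p.1 < 0 -> f p.1 p.2 = c (fun=> 0%N).
Proof.
move=> [r0 _ fE] p0; rewrite fE // dcoords_id ?pwsum0 // => i.
by rewrite normr0.
Qed.

(** The spatial Hessian of the series at its centre, read off the coefficients; its symmetry is then
    just [sh_comm]. *)
Definition hcoef (c : ('I_d.+1 -> nat) -> R) : 'M[R]_d :=
  \matrix_(i, j) sh (xi i) (sh (xi j) c) (fun=> 0%N).

Lemma psrepr_hess f p r c : psrepr f p r c -> p.1 < 0 -> hess f p.1 p.2 = hcoef c.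
Proof.
move=> rf p0; apply/matrixP => i j; rewrite !mxE.
exact: psrepr_center (psrepr_pdx i (psrepr_pdx j rf)) p0.
Qed.

Lemma hcoef_sym c : symmetric_mx (hcoef c).
Proof. by apply/matrixP => i j; rewrite !mxE sh_comm. Qed.

Lemma psrepr_lip f p r c : psrepr f p r c ->
  exists2 K : R, 0 <= K & forall q q', (forall i, `|dcoords p q i| <= r / 2) ->
    (forall i, `|dcoords p q' i| <= r / 2) -> q.1 < 0 -> q'.1 < 0 ->
    `|f q.1 q.2 - f q'.1 q'.2| <= K * \sum_i `|dcoords q q' i|.
Proof.
move=> [r0 ca fE]; have r2 : r / 2 < r by lra.
have [|K K0 HK] := @pwsum_lip _ _ c r (r / 2) ca _ r2; first by rewrite divr_ge0 // ltW.
exists K => // q q' qr q'r q0 q'0.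
rewrite !fE //; try by move=> i; apply: le_lt_trans r2.
apply: le_trans (HK _ _ qr q'r) _; apply: ler_wpM2l => //; apply: ler_sum => i _.
rewrite distrC (_ : dcoords p q' i - dcoords p q i = dcoords q q' i) //.
by rewrite /dcoords; ring.
Qed.

Lemma psrepr_bounded f p r c : psrepr f p r c ->
  exists2 M : R, 0 <= M & forall q, (forall i, `|dcoords p q i| <= r / 2) -> q.1 < 0 ->
    `|f q.1 q.2| <= M.
Proof.
move=> [r0 ca fE]; have r2 : r / 2 < r by lra.
have [|M M0 HM] := @pwsum_bound _ _ c r (r / 2) ca _ r2; first by rewrite divr_ge0 // ltW.
exists M => // q qr q0; rewrite fE //; first exact: (HM _ qr).2.
by move=> i; apply: le_lt_trans r2.
Qed.

Lemma psrepr_cont f p r c : psrepr f p r c -> p.1 < 0 ->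
  {for p, continuous (fun q : R * 'rV[R]_d => f q.1 q.2)}.
Proof.
move=> rf p0; have [K K0 HK] := psrepr_lip rf; have [r0 _ _] := rf.
apply/cvgrPdist_le => /= e e0.
pose e1 := e / ((K + 1) * d.+1%:R).
have K1 : 0 < (K + 1) * d.+1%:R by rewrite mulr_gt0 // ltr_wpDl.
have e10 : 0 < e1 by rewrite divr_gt0.
have m0 : 0 < Num.min (r / 2) (Num.min (- p.1) e1).
  by rewrite !lt_min e10 oppr_gt0 p0 divr_gt0.
have := polydisc_nbhs p m0; apply: filterS => q qm.
have q1 i : `|dcoords p q i| <= r / 2.
  by move: (qm i); rewrite !lt_min => /and3P[/ltW].
have q2 i : `|dcoords p q i| <= e1.
  by move: (qm i); rewrite !lt_min => /and3P[_ _ /ltW].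
have q0 : q.1 < 0.
  move: (qm ord0); rewrite dcoords_t !lt_min => /and3P[_ H _].
  by have := ler_norm (q.1 - p.1); lra.
apply: le_trans (HK p q _ q1 p0 q0) _.
  by move=> i; rewrite dcoords_id normr0 divr_ge0 // ltW.
apply: le_trans (ler_wpM2l K0 (ler_sum _ (fun i _ => q2 i))) _.
rewrite sumr_const card_ord -mulr_natr.
have -> : e = (K + 1) * (e1 * d.+1%:R).
  by rewrite mulrCA /e1 divfK // gt_eqF.
by rewrite ler_wpM2r ?lerDl // mulr_ge0 // ltW.
Qed.

Lemma Q1_polydisc p : Q1 d p -> exists2 e : R, 0 < e &
  forall q, (forall i, `|dcoords p q i| < e) -> q.1 <= 0 -> Q1 d q.
Proof.
move=> [/andP[p1 p0]]; rewrite /B1 /eball /= expr1n => pB.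
(* For a displacement [z] with [|z| <= e <= 1], each coordinate satisfies
   [(x + z) ^ 2 <= x ^ 2 + e (2 |x| + 1)]; summing gives [S]. *)
pose S := \sum_(i < d) (2 * `|p.2 0 i| + 1) + 1.
have S0 : 0 < S by rewrite ltr_wpDl // sumr_ge0 // => i _; rewrite addr_ge0 // mulr_ge0.
pose e := Num.min 1 (Num.min (p.1 + 1) ((1 - sqnorm p.2) / S)).
have e0 : 0 < e by rewrite !lt_min ltr01 divr_gt0 ?subr_gt0 // andbT -ltrBlDr sub0r.
exists e => // q qe q0; split.
  rewrite q0 andbT; have := qe ord0; rewrite dcoords_t !lt_min => /and3P[_ + _].
  by have := ler_norm (p.1 - q.1); rewrite distrC; lra.
rewrite /B1 /eball /= expr1n.
have e1 : e <= 1 by rewrite ge_min lexx.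
have eS : e * S <= 1 - sqnorm p.2.
  by rewrite -ler_pdivlMr // !ge_min lexx !orbT.
have : sqnorm q.2 <= sqnorm p.2 + e * \sum_(i < d) (2 * `|p.2 0 i| + 1).
  rewrite mulr_sumr -big_split; apply: ler_sum => i _ /=.
  have := qe (xi i); rewrite dcoords_x => /ltW.
  have -> : q.2 0 i = (q.2 0 i - p.2 0 i) + p.2 0 i by rewrite subrK.
  rewrite addrK; move: (p.2 0 i) (q.2 0 i - p.2 0 i) => x z ze.
  rewrite sqrrD -[z ^+ 2]real_normK ?num_real //.
  have H1 : `|z| ^+ 2 <= e by rewrite expr2 -[e]mulr1 ler_pM // (le_trans ze).
  have H2 : z * x <= e * `|x|.
    by rewrite (le_trans (ler_norm _)) // normrM ler_wpM2r.
  by rewrite -mulr_natl; lra.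
by move: eS; rewrite /S mulrDr mulr1; lra.
Qed.

(* Same as [psrepr], but including the terminal slice. *)
Definition crepr f p (r : R) c := [/\ 0 < r, absconv c r &
  forall q, (forall i, `|dcoords p q i| < r) -> q.1 <= 0 ->
    Q1 d q /\ f q.1 q.2 = pwsum c (dcoords p q)].

Lemma crepr_psrepr f p r c : crepr f p r c -> psrepr f p r c.
Proof. by move=> [r0 ca fE]; split=> // q qr q0; have [] := fE q qr (ltW q0). Qed.

Lemma crepr_of_analytic u p : Q1 d p -> analytic_at_Q1 u p -> exists r c, crepr u p r c.
Proof.
move=> Qp [r [c [r0 [H1 H2]]]]; have [e e0 He] := Q1_polydisc Qp.
have H q : (forall i, `|dcoords p q i| < Num.min r e) -> q.1 <= 0 ->
    Q1 d q /\ u q.1 q.2 = pwsum c (dcoords p q).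
  move=> qe q0; have Qq : Q1 d q.
    by apply: He => // i; move: (qe i); rewrite lt_min => /andP[].
  split=> //; apply/esym/cvg_lim; first exact: Rhausdorff.
  by apply: H2 => // i; move: (qe i); rewrite lt_min => /andP[].
exists (Num.min r e), c; split=> //; first by rewrite lt_min r0.
move=> rho rho0; rewrite lt_min => /andP[rhor _].
(* The point [p + (rho, ..., rho)] turns pointwise absolute convergence into the diagonal form of
   [absconv]. It may lie outside [Q1], where the series still converges absolutely. *)
have E : dcoords p (p.1 + rho, p.2 + const_mx rho) = fun=> rho.
  apply/funext; apply: coordsP => [|j]; rewrite ?dcoords_t ?dcoords_x /= ?mxE.
    by rewrite addrAC subrr add0r.
  by rewrite addrAC subrr add0r.
have Ei i : coords (p.1 + rho, p.2 + const_mx rho) i - coords p i = rho.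
  by move: (congr1 (@^~ i) E).
have [|M HM] := H1 (p.1 + rho, p.2 + const_mx rho).
  by move=> i; rewrite Ei ger0_norm.
exists M => N; apply: le_trans (HM N).
apply: ler_psum => [a|i]; first by rewrite normr_ge0 lexx.
by rewrite Ei ger0_norm // rho0 lexx.
Qed.

End Coordinates.

(** * From viscosity to classical solutions *)

Section Ellipticity.
Context {R : realType} {d : nat}.
Implicit Types (A B M : 'M[R]_d) (v : 'rV[R]_d) (F : 'M[R]_d -> R).

Lemma qformE M v : (v *m M *m v^T) 0 0 = \sum_i \sum_j v 0 i * M i j * v 0 j.
Proof.
rewrite !mxE exchange_big; apply: eq_bigr => j _; rewrite !mxE mulr_suml.
by apply: eq_bigr => i _.
Qed.

Lemma sqnorm_ge0 v : 0 <= sqnorm v.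
Proof. by apply: sumr_ge0 => i _; rewrite sqr_ge0. Qed.

Lemma qform_scalar (k : R) v : (v *m k%:M *m v^T) 0 0 = k * sqnorm v.
Proof.
rewrite mul_mx_scalar -scalemxAl !mxE; congr (_ * _).
by apply: eq_bigr => i _; rewrite mxE.
Qed.

Lemma qform_bound M v :
  (v *m M *m v^T) 0 0 <= (\sum_i \sum_j `|M i j|) * sqnorm v.
Proof.
rewrite qformE mulr_suml; apply: ler_sum => i _; rewrite mulr_suml.
apply: ler_sum => j _; rewrite mulrAC [X in X <= _]mulrC.
apply: le_trans (ler_norm _) _; rewrite normrM ler_wpM2l //.
have vk k : v 0 k ^+ 2 <= sqnorm v.
  by rewrite /sqnorm (bigD1 k) //= lerDl sumr_ge0 // => l _; rewrite sqr_ge0.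
have h1 := vk i; have h2 := vk j; rewrite ler_norml.
have := sqr_ge0 (v 0 i - v 0 j); have := sqr_ge0 (v 0 i + v 0 j).
by rewrite sqrrD sqrrB => ? ?; apply/andP; split; lra.
Qed.

Lemma psd_scalar (k : R) : 0 <= k -> psd_mx (k%:M : 'M[R]_d).
Proof. by move=> k0 v; rewrite qform_scalar mulr_ge0 // sqnorm_ge0. Qed.

Lemma psd_tr M : psd_mx M -> 0 <= \tr M.
Proof.
move=> pM; apply: sumr_ge0 => i _; have := pM (evec i).
rewrite qformE (bigD1 i) //= (bigD1 i) //= !mxE !eqxx mul1r mulr1.
rewrite big1 ?addr0 => [|j ji]; last by rewrite !mxE (negbTE ji) mulr0.
rewrite big1 ?addr0 // => k ki; apply: big1 => j _.
by rewrite !mxE (negbTE ki) !mul0r.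
Qed.

Lemma sym_scalar (k : R) : symmetric_mx (k%:M : 'M[R]_d).
Proof. exact: tr_scalar_mx. Qed.

Lemma symD A B : symmetric_mx A -> symmetric_mx B -> symmetric_mx (A + B).
Proof. by rewrite /symmetric_mx linearD /= => -> ->. Qed.

Lemma symB A B : symmetric_mx A -> symmetric_mx B -> symmetric_mx (A - B).
Proof. by rewrite /symmetric_mx linearB /= => -> ->. Qed.

Variables (F : 'M[R]_d -> R) (lam Lam : R).
Hypotheses (lam0 : 0 <= lam) (FE : unif_elliptic F lam Lam).

(** Test ellipticity with [A = 0] and [B] the identity. *)
Lemma ell_ge0 : 0 <= Lam * d%:R.
Proof.
have [H1 H2] := FE (trmx0 _ _ _) (sym_scalar 1) (psd_scalar ler01).
move: (le_trans H1 H2); rewrite mxtrace1 => H.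
by apply: le_trans H; rewrite mulr_ge0.
Qed.

Lemma ell_mono A B : symmetric_mx A -> symmetric_mx B -> psd_mx (B - A) -> F A <= F B.
Proof.
move=> sA sB pBA; have [+ _] := FE sA (symB sB sA) pBA.
rewrite addrCA subrr addr0 => H; rewrite -subr_ge0; apply: le_trans H.
by rewrite mulr_ge0 // psd_tr.
Qed.

Lemma ell_scalar A (k : R) : symmetric_mx A -> 0 <= k ->
  F (A + k%:M) <= F A + Lam * (d%:R * k).
Proof.
move=> sA k0; have [_] := FE sA (sym_scalar k) (psd_scalar k0).
by rewrite mxtrace_scalar mulr_natl -lerBlDl.
Qed.

(** With [K] the sum of the absolute entries of [A - B], one has [A <= B + K I] as quadratic forms;
    monotonicity and the upper ellipticity bound conclude, and the roles of [A] and [B] can be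
    exchanged. *)
Lemma ell_lip A B : symmetric_mx A -> symmetric_mx B ->
  `|F A - F B| <= Lam * d%:R * \sum_i \sum_j `|A i j - B i j|.
Proof.
move=> sA sB; pose K := \sum_i \sum_j `|A i j - B i j|.
have H A' B' : symmetric_mx A' -> symmetric_mx B' ->
    K = \sum_i \sum_j `|A' i j - B' i j| -> F A' <= F B' + Lam * d%:R * K.
  move=> sA' sB' EK; have K0 : 0 <= K.
    by apply: sumr_ge0 => i _; apply: sumr_ge0.
  rewrite -mulrA; apply: le_trans (ell_scalar sB' K0).
  apply: ell_mono => //; first by apply: symD => //; exact: sym_scalar.
  move=> v; rewrite addrAC -opprB mulmxDr mulmxDl mulmxN mulNmx mxE qform_scalar mxE addrC subr_ge0.
  apply: le_trans (qform_bound _ _) _; rewrite EK ler_wpM2r ?sqnorm_ge0 //.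
  by apply: ler_sum => i _; apply: ler_sum => j _; rewrite !mxE.
have h1 := H A B sA sB erefl.
have h2 : F B <= F A + Lam * d%:R * K.
  apply: H => //; apply: eq_bigr => i _; apply: eq_bigr => j _; exact: distrC.
by rewrite -/K ler_norml; apply/andP; split; lra.
Qed.

End Ellipticity.

Lemma is_derive_line {R : realType} {V : normedModType R} (f : V -> R) (x v : V) (L : R) :
  is_derive (0 : R) (1 : R) (fun h : R => f (x + h *: v)) L -> is_derive x v f L.
Proof.
have E : (fun h : R => h^-1 *: (((fun h : R => f (x + h *: v)) \o shift 0) (h *: 1)
    - f (x + 0 *: v))) = (fun h : R => h^-1 *: ((f \o shift x) (h *: v) - f x)).
  apply/funext => h /=; rewrite scale0r !addr0 [h *: v + x]addrC.
  by rewrite /GRing.scale /= mulr1.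
move=> [H1 H2]; split.
  by move: H1; rewrite /derivable E.
by rewrite -H2 /derive E.
Qed.

Lemma continuous_sum_seq {R : realType} (T : topologicalType) (I : Type) (s : seq I)
    (P : pred I) (f : I -> T -> R) : (forall i, continuous (f i)) ->
  continuous (fun x => \sum_(i <- s | P i) f i x).
Proof.
move=> fc x; elim: s => [|i s IH].
  by under eq_fun do rewrite big_nil; exact: cvg_cst.
under eq_fun do rewrite big_cons; case: (P i) => //.
by apply: cvgD => //; exact: fc.
Qed.

Lemma continuous_prod_seq {R : realType} (T : topologicalType) (I : Type) (s : seq I)
    (P : pred I) (f : I -> T -> R) : (forall i, continuous (f i)) ->
  continuous (fun x => \prod_(i <- s | P i) f i x).
Proof.
move=> fc x; elim: s => [|i s IH].
  by under eq_fun do rewrite big_nil; exact: cvg_cst.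
under eq_fun do rewrite big_cons; case: (P i) => //.
by apply: cvgM => //; exact: fc.
Qed.

(** * Quadratic test functions and the pointwise equation *)

Section QuadraticTest.
Context {R : realType} {d : nat}.
Implicit Types (p q : R * 'rV[R]_d) (c : ('I_d.+1 -> nat) -> R).

(** The degree bound is explicit because each derivative lowers it by one; the bound [2] leaves room
    for exactly two space derivatives. *)
Definition polyfun p c N (t : R) (x : 'rV[R]_d) : R := psum c (dcoords p (t, x)) N.

Lemma polyfun_is_derive_t p c N t x :
  is_derive t (1 : R) (fun s => polyfun p c N.+1 s x) (polyfun p (sh ord0 c) N t x).
Proof.
apply: is_derive_line.
have -> : (fun h : R => polyfun p c N.+1 (t + h *: 1) x) =
    (fun h : R => psum c (fun i => dcoords p (t, x) i + h * coords (1, 0 : 'rV[R]_d) i) N.+1).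
  by apply/funext => h; rewrite /polyfun -(dcoords_line _ (t, x)) /= scaler0 addr0.
apply: is_derive_eq (is_derive_psum _ _ _ _ _) _.
rewrite dirsh_t /polyfun; congr psum; apply/funext => i.
by rewrite mul0r addr0.
Qed.

Lemma polyfun_is_derive_x p c N t x j :
  is_derive x (evec j) (polyfun p c N.+1 t) (polyfun p (sh (xi j) c) N t x).
Proof.
apply: is_derive_line.
have -> : (fun h : R => polyfun p c N.+1 t (x + h *: evec j)) =
    (fun h : R => psum c (fun i => dcoords p (t, x) i + h * coords (0, evec j) i) N.+1).
  by apply/funext => h; rewrite /polyfun -(dcoords_line _ (t, x)) /= mulr0 addr0.
apply: is_derive_eq (is_derive_psum _ _ _ _ _) _.
rewrite dirsh_x /polyfun; congr psum; apply/funext => i.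
by rewrite mul0r addr0.
Qed.

Lemma pdt_polyfun p c N : pdt (polyfun p c N.+1) = polyfun p (sh ord0 c) N.
Proof.
by apply/funext => t; apply/funext => x; have [_] := polyfun_is_derive_t p c N t x.
Qed.

Lemma pdx_polyfun p c N j : pdx j (polyfun p c N.+1) = polyfun p (sh (xi j) c) N.
Proof.
by apply/funext => t; apply/funext => x; have [_] := polyfun_is_derive_x p c N t x j.
Qed.

Lemma jcont_polyfun p c N : jcont (polyfun p c N).
Proof.
have cc i : continuous (fun q : R * 'rV[R]_d => dcoords p (q.1, q.2) i).
  move=> q; apply/cvgrPdist_lt => e e0.
  have := polydisc_nbhs q e0; apply: filterS => q' /(_ i).
  rewrite -!surjective_pairing.
  suff -> : `|dcoords p q i - dcoords p q' i| = `|dcoords q q' i| by [].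
  by rewrite -normrN; congr `|_|; rewrite /dcoords; ring.
rewrite /jcont /polyfun /psum; apply: continuous_sum_seq => a q.
apply: cvgMr; move: q; apply: continuous_prod_seq => i q.
elim: (a i : nat) => [|k IH]; first by under eq_fun do rewrite expr0; exact: cvg_cst.
by under eq_fun do rewrite exprS; apply: cvgM => //; exact: cc.
Qed.

Lemma polyfun_C12 p c : C12 (polyfun p c 2).
Proof.
do !split.
- by move=> t x; have [] := polyfun_is_derive_t p c 1 t x.
- by move=> t x i; have [] := polyfun_is_derive_x p c 1 t x i.
- by move=> t x i j; rewrite pdx_polyfun; have [] := polyfun_is_derive_x p (sh (xi j) c) 0 t x i.
- exact: jcont_polyfun.
- by rewrite pdt_polyfun; exact: jcont_polyfun.
- by move=> i; rewrite pdx_polyfun; exact: jcont_polyfun.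
- by move=> i j; rewrite !pdx_polyfun; exact: jcont_polyfun.
Qed.

(* [psum sqcoef y 2] is the sum of the squares of the coordinates. *)
Definition sqcoef {n : nat} (a : 'I_n -> nat) : R :=
  ([forall i, ~~ odd (a i)] && [exists i, a i != 0%N])%:R.

Lemma sqcoef_ge0 n (y : 'I_n -> R) a : 0 <= sqcoef a * monom y a.
Proof.
rewrite /sqcoef; case: forallP => [ev|_]; last by rewrite mul0r.
rewrite mulr_ge0 // ?ler0n //; apply: prodr_ge0 => i _.
by rewrite exprn_even_ge0.
Qed.

Lemma psum_sqcoef n (y : 'I_n -> R) j : `|y j| ^+ 2 <= psum sqcoef y 2.
Proof.
pose a : {ffun 'I_n -> 'I_3} := [ffun i => inord (2 * (i == j))].
have aE i : (a i : nat) = (2 * (i == j))%N.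
  by rewrite ffunE inordK //; case: (i == j).
rewrite /psum (bigD1 a) /=; last first.
  by rewrite (bigD1 j) //= aE eqxx big1 // => i /negbTE ij; rewrite aE ij.
rewrite -[leLHS]addr0 lerD //; last by apply: sumr_ge0 => b _; exact: sqcoef_ge0.
have -> : sqcoef (fun i => a i : nat) = 1.
  rewrite /sqcoef; have -> : [forall i, ~~ odd (a i)].
    by apply/forallP => i; rewrite aE; case: (i == j).
  by have -> // : [exists i, (a i : nat) != 0%N]; apply/existsP; exists j; rewrite aE eqxx.
rewrite mul1r /monom (bigD1 j) //= aE eqxx muln1 big1 ?mulr1; last first.
  by move=> i /negbTE ij; rewrite aE ij.
by rewrite real_normK ?num_real.
Qed.

Lemma ex_maxcoord n (y : 'I_n.+1 -> R) : exists j, forall i, `|y i| <= `|y j|.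
Proof.
exists [arg max_(i > ord0) `|y i|]%O; case: arg_maxP => // j _ H i; exact: H.
Qed.

Lemma sqcoef0 n : sqcoef (fun _ : 'I_n => 0%N) = 0.
Proof.
rewrite /sqcoef; have -> : [exists i : 'I_n, 0%N != 0%N] = false by apply/existsP => -[].
by rewrite andbF.
Qed.

Lemma sqcoef_odd n (a : 'I_n -> nat) i : odd (a i) -> sqcoef a = 0.
Proof.
by move=> oa; rewrite /sqcoef; case: forallP => // /(_ i); rewrite oa.
Qed.

Lemma hcoef_test c (k : R) :
  hcoef (fun a => c a + k * sqcoef a) = hcoef c + (2 * k)%:M :> 'M[R]_d.
Proof.
apply/matrixP => i j; rewrite !mxE /sh !mulrDr; congr (_ + _).
have [<-|ij] := eqVneq i j.
  rewrite eqxx mulr1n mul1r add0n /= mulrC; suff -> : sqcoef (fun k : 'I_d.+1 =>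
    (0 + (k == xi i) + (k == xi i))%N) = 1 by rewrite mulr1 mulrC.
  rewrite /sqcoef; have -> : [forall l, ~~ odd (0 + (l == xi i) + (l == xi i))].
    by apply/forallP => l; case: (l == _).
  by have -> // : [exists l, (0 + (l == xi i) + (l == xi i))%N != 0%N];
    apply/existsP; exists (xi i); rewrite eqxx.
rewrite (@sqcoef_odd _ _ (xi i)) ?mulr0 ?mulr0n //.
by rewrite eqxx /xi (inj_eq lift_inj) (negbTE ij).
Qed.

(** The remainder after degree [2] is at most [C m ^ 3] in the largest displacement [m], hence below
    [k m ^ 2] once [m <= k / (C + 1)]. *)
Lemma psrepr_touch (u : R -> 'rV[R]_d -> R) p r c (k : R) : p.1 < 0 -> psrepr u p r c ->
  0 < k -> \forall q \near p,
    `|u q.1 q.2 - psum c (dcoords p q) 2| <= k * psum sqcoef (dcoords p q) 2.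
Proof.
move=> p0 [r0 ca uE] k0; have r2 : r / 2 < r by lra.
have r20 : 0 < r / 2 by lra.
have [C C0 HC] := @pwsum_tail _ _ c r (r / 2) 2 ca r20 r2.
have m0 : 0 < Num.min (r / 2) (Num.min (- p.1) (k / (C + 1))).
  by rewrite !lt_min r20 oppr_gt0 p0 divr_gt0 // ltr_wpDl.
have := polydisc_nbhs p m0; apply: filterS => q qm.
have q1 i : `|dcoords p q i| < r / 2.
  by move: (qm i); rewrite !lt_min => /and3P[].
have q2 i : `|dcoords p q i| * (C + 1) <= k.
  by move: (qm i); rewrite !lt_min => /and3P[_ _ /ltW]; rewrite ler_pdivlMr // ltr_wpDl.
have q0 : q.1 < 0.
  move: (qm ord0); rewrite dcoords_t !lt_min => /and3P[_ H _].
  by have := ler_norm (q.1 - p.1); lra.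
rewrite uE //; last by move=> i; apply: lt_trans r2.
have [j Hj] := ex_maxcoord (dcoords p q).
apply: le_trans (HC _ `|dcoords p q j| (ltW (q1 j)) Hj (normr_ge0 _)) _.
apply: (@le_trans _ _ (k * `|dcoords p q j| ^+ 2)); last first.
  by rewrite ler_wpM2l ?psum_sqcoef // ltW.
rewrite exprS mulrA ler_wpM2r ?exprn_ge0 //; apply: le_trans (q2 j).
by rewrite mulrC ler_wpM2l // lerDl.
Qed.

(** The second-order Taylor polynomial plus or minus [k] times the sum of squares touches [u] from
    above or below. The perturbation leaves the time derivative at [p] alone and moves the Hessian
    by [2 k] times the identity, which by [ell_scalar] costs at most [2 k d Lam]; [k] makes this at
    most [e]. *)
Lemma visc_classical F (lam Lam : R) (u : R -> 'rV[R]_d -> R) p r c :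
  0 <= lam -> unif_elliptic F lam Lam -> visc_solution F u ->
  Q1 d p -> p.1 < 0 -> psrepr u p r c ->
  sh ord0 c (fun=> 0%N) = F (hcoef c).
Proof.
move=> lam0 FE [_ [Vsub Vsup]] Qp p0 ru.
have p2 : (p.1, p.2) = p by case: p {Qp p0 ru}.
pose T (k : R) := polyfun p (fun a => c a + k * sqcoef a) 2.
have Tp k q : T k q.1 q.2 = psum c (dcoords p q) 2 + k * psum sqcoef (dcoords p q) 2.
  by rewrite /T /polyfun -surjective_pairing psumD psumZ.
have Tt k : pdt (T k) p.1 p.2 = sh ord0 c (fun=> 0%N).
  rewrite /T pdt_polyfun /polyfun p2 dcoords_id psum0 /sh mulrDr.
  by rewrite (@sqcoef_odd _ _ ord0) ?mulr0 ?addr0 // eqxx.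
have Th k : hess (T k) p.1 p.2 = hcoef c + (2 * k)%:M.
  rewrite -hcoef_test; apply/matrixP => i j; rewrite !mxE.
  by rewrite /T !pdx_polyfun /polyfun p2 dcoords_id psum0.
have T0 k : T k p.1 p.2 = u p.1 p.2.
  rewrite Tp dcoords_id !psum0 sqcoef0 mulr0 addr0.
  by rewrite (psrepr_center ru).
have dL := ell_ge0 lam0 FE.
have le1 : sh ord0 c (fun=> 0%N) <= F (hcoef c).
  apply/ler_addgt0Pl => e e0.
  pose k := e / (2 * (Lam * d%:R + 1)).
  have k0 : 0 < k by rewrite divr_gt0 // mulr_gt0 // ltr_wpDl.
  have ke : Lam * (d%:R * (2 * k)) <= e.
    have -> : e = k * (2 * (Lam * d%:R + 1)) by rewrite /k divfK // gt_eqF // mulr_gt0 // ltr_wpDl.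
    have -> : Lam * (d%:R * (2 * k)) = k * (2 * (Lam * d%:R)) by ring.
    by rewrite ler_pM2l // ler_pM2l // lerDl.
  have : pdt (T k) p.1 p.2 - F (hess (T k) p.1 p.2) <= 0.
    apply: Vsub => //; first exact: polyfun_C12.
    have := psrepr_touch p0 ru k0; apply: filterS => q qk _.
    rewrite T0 subrr Tp opprD addrA subr_le0; apply: le_trans qk; exact: ler_norm.
  rewrite Tt Th subr_le0 => H; apply: le_trans H _.
  apply: le_trans (ell_scalar FE (hcoef_sym c) (_ : 0 <= 2 * k)) _.
    by rewrite mulr_ge0 // ltW.
  by rewrite addrC lerD2r.
have le2 : F (hcoef c) <= sh ord0 c (fun=> 0%N).
  apply/ler_addgt0Pl => e e0.
  pose k := e / (2 * (Lam * d%:R + 1)).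
  have k0 : 0 < k by rewrite divr_gt0 // mulr_gt0 // ltr_wpDl.
  have ke : Lam * (d%:R * (2 * k)) <= e.
    have -> : e = k * (2 * (Lam * d%:R + 1)) by rewrite /k divfK // gt_eqF // mulr_gt0 // ltr_wpDl.
    have -> : Lam * (d%:R * (2 * k)) = k * (2 * (Lam * d%:R)) by ring.
    by rewrite ler_pM2l // ler_pM2l // lerDl.
  have : pdt (T (- k)) p.1 p.2 - F (hess (T (- k)) p.1 p.2) >= 0.
    apply: Vsup => //; first exact: polyfun_C12.
    have := psrepr_touch p0 ru k0; apply: filterS => q qk _.
    rewrite T0 subrr Tp opprD addrA mulNr opprK -lerBlDr sub0r.
    by move: qk; rewrite ler_norml => /andP[].
  rewrite Tt Th subr_ge0 => H.
  have s1 : symmetric_mx (hcoef c + (2 * - k)%:M).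
    by apply: symD (hcoef_sym c) (sym_scalar _).
  have := ell_scalar FE s1 (_ : 0 <= 2 * k); rewrite -addrA -raddfD /= mulrN addNr raddf0 addr0.
  move=> H'; apply: le_trans (H' _) _; first by rewrite mulr_ge0 // ltW.
  by rewrite addrC lerD // -mulrN.
by apply/eqP; rewrite eq_le le1.
Qed.

End QuadraticTest.

(** * Self-similarity *)

Section TimeLines.
Context {R : realType} {d : nat}.
Implicit Types (p q : R * 'rV[R]_d) (f g u : R -> 'rV[R]_d -> R).
Implicit Types (c : ('I_d.+1 -> nat) -> R) (x : 'rV[R]_d) (r : R).

Lemma dcoords_tline p (t : R) (x : 'rV[R]_d) : dcoords p (t, x) =
  fun i => dcoords p (0, x) i + t * coords (1, 0 : 'rV[R]_d) i.
Proof. by rewrite -(dcoords_line _ (0, x)) /= add0r mulr1 scaler0 addr0. Qed.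

Lemma is_derive_tseries c r p x m (t : R) : 0 < r -> absconv c r ->
  (forall i, `|dcoords p (t, x) i| < r) ->
  is_derive t (1 : R) (fun s => pwsum (iter m (sh ord0) c) (dcoords p (s, x)))
    (pwsum (iter m.+1 (sh ord0) c) (dcoords p (t, x))).
Proof.
move=> r0 ca tr.
rewrite (_ : (fun s => _) = fun s : R => pwsum (iter m (sh ord0) c)
  (fun i => dcoords p (0, x) i + s * coords (1, 0 : 'rV[R]_d) i)); last first.
  by apply/funext => s; rewrite -dcoords_tline.
rewrite /= -[sh ord0 (iter _ _ _)]dirsh_t [dcoords p (t, x)]dcoords_tline; apply: (is_derive_pwsum (r := r)) => //.
  exact: absconv_iter_sh.
by move=> i; move: (tr i); rewrite dcoords_tline.
Qed.

Lemma pwsum_zero_x c r p (t : R) j : 0 < r -> absconv c r ->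
  (forall x, (forall i, `|dcoords p (t, x) i| < r) -> pwsum c (dcoords p (t, x)) = 0) ->
  forall x, (forall i, `|dcoords p (t, x) i| < r) ->
    pwsum (sh (xi j) c) (dcoords p (t, x)) = 0.
Proof.
move=> r0 ca c0 x xr; pose v : 'I_d.+1 -> R := coords (0, evec j).
have E (s : R) : (fun i => dcoords p (t, x) i + s * v i) = dcoords p (t, x + s *: evec j).
  by rewrite -(dcoords_line p (t, x)) /= mulr0 addr0.
have y0 : (fun i => dcoords p (t, x) i + 0 * v i) = dcoords p (t, x).
  by apply/funext => i; rewrite mul0r addr0.
have H : is_derive (0 : R) (1 : R)
    (fun s : R => pwsum c (fun i => dcoords p (t, x) i + s * v i))
    (pwsum (sh (xi j) c) (dcoords p (t, x))).
  rewrite -dirsh_x -[X in pwsum (dirsh _ _) X]y0.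
  by apply: (is_derive_pwsum (r := r)) => // i; rewrite mul0r addr0.
have [e e0 He] := polydisc_line v r0 xr.
have N0 : \forall s \near (0 : R),
    pwsum c (fun i => dcoords p (t, x) i + s * v i) = cst 0 s.
  have : \forall s \near (0 : R), `|s| < e by exact: nbhs0_lt.
  apply: filterS => s /He Hs; rewrite E c0 // => i.
  by move: (Hs i); rewrite -[X in `|X|]/((fun i => dcoords p (t, x) i + s * v i) i) E.
have [_ <-] := near_eq_is_derive N0 H.
exact: derive_cst.
Qed.

Lemma shB i c c' : sh i (fun a => c a - c' a) = fun a => sh i c a - sh i c' a.
Proof. by apply/funext => a; rewrite /sh mulrBr. Qed.

Lemma absconvB c c' r : absconv c r -> absconv c' r -> absconv (fun a => c a - c' a) r.
Proof.
move=> ca ca'; have := absconvD ca (absconvZ (-1) ca').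
by under eq_fun do rewrite mulN1r.
Qed.

Lemma polydisc_time x0 x r (t : R) : (forall i, `|dcoords (0, x0) (0, x) i| < r) ->
  `|t| < r -> forall i, `|dcoords (0, x0) (t, x) i| < r.
Proof.
move=> xr tr; apply: coordsP => [|j]; first by rewrite dcoords_t subr0.
by have := xr (xi j); rewrite !dcoords_x.
Qed.

(* The difference [V] of two solutions agreeing at [t = 0] satisfies
   [|V_t| <= C |D^2 V|]; if [V] vanishes to order [k] in time then so does [D^2 V],
   hence [V_t], and [V] vanishes to order [k + 1]. *)
Lemma terminal_flat (F : 'M[R]_d -> R) (lam Lam : R) f g x0 r cf cg :
  0 <= lam -> unif_elliptic F lam Lam ->
  crepr f (0, x0) r cf -> crepr g (0, x0) r cg ->
  (forall q, Q1 d q -> q.1 < 0 -> pdt f q.1 q.2 = F (hess f q.1 q.2)) ->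
  (forall q, Q1 d q -> q.1 < 0 -> pdt g q.1 q.2 = F (hess g q.1 q.2)) ->
  (forall x, Q1 d (0, x) -> f 0 x = g 0 x) ->
  forall m, iter m (sh ord0) (fun a => cf a - cg a) (fun=> 0%N) = 0.
Proof.
move=> lam0 FE rf rg Pf Pg fg0.
have [r0 caf fE] := rf; have [_ cag gE] := rg.
pose p : R * 'rV[R]_d := (0, x0); pose c a := cf a - cg a.
have ca : absconv c r by exact: absconvB.
have r2 : r / 2 < r by lra.
have Q q : (forall i, `|dcoords p q i| < r) -> q.1 <= 0 -> Q1 d q.
  by move=> qr q0; have [] := fE q qr q0.
have ineq q : (forall i, `|dcoords p q i| < r) -> q.1 < 0 ->
    `|pwsum (sh ord0 c) (dcoords p q)| <= Lam * d%:R *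
      \sum_i \sum_j `|pwsum (sh (xi i) (sh (xi j) c)) (dcoords p q)|.
  move=> qr q0; have Qq := Q q qr (ltW q0).
  have pf := crepr_psrepr rf; have pg := crepr_psrepr rg.
  have hE h ch i j : psrepr h p r ch ->
      hess h q.1 q.2 i j = pwsum (sh (xi i) (sh (xi j) ch)) (dcoords p q).
    by move=> ph; rewrite mxE; have [_ _ ->] := psrepr_pdx i (psrepr_pdx j ph).
  have hs h ch : psrepr h p r ch -> symmetric_mx (hess h q.1 q.2).
    by move=> ph; apply/matrixP => i j; rewrite mxE !(hE _ _ _ _ ph) sh_comm.
  have := ell_lip lam0 FE (hs _ _ pf) (hs _ _ pg).
  rewrite -Pf // -Pg //.
  have [_ a1 ->//] := psrepr_pdt pf; have [_ a2 ->//] := psrepr_pdt pg.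
  rewrite -(pwsumB r0 a1 a2 qr) -shB => H; apply: le_trans H _.
  rewrite le_eqVlt; apply/orP; left; apply/eqP; congr (_ * _).
  apply: eq_bigr => i _; apply: eq_bigr => j _.
  rewrite (hE _ _ _ _ pf) (hE _ _ _ _ pg) -(pwsumB (r := r)) // -?shB //.
    by do 2 apply: absconv_sh.
  by do 2 apply: absconv_sh.
(* The claim covers all nearby [x], not only [x0], because the induction differentiates the
   vanishing of the lower time coefficients in [x]. *)
suff claim k : forall x, (forall i, `|dcoords p (0, x) i| < r) ->
    pwsum (iter k (sh ord0) c) (dcoords p (0, x)) = 0.
  move=> m; have := claim m x0; rewrite dcoords_id pwsum0; apply.
  by move=> i; rewrite normr0.
elim/ltn_ind: k => -[_ x xr|k IH x xr].
  rewrite /= (pwsumB r0 caf cag xr).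
  have [Qx /= <-] := fE _ xr (lexx 0); have [_ /= <-] := gE _ xr (lexx 0).
  by rewrite fg0 // subrr.
have zeroD i j m : (m < k.+1)%N ->
    pwsum (iter m (sh ord0) (sh (xi i) (sh (xi j) c))) (dcoords p (0, x)) = 0.
  move=> mk; rewrite !iter_sh_comm.
  apply: (pwsum_zero_x (r := r)) => //; first by apply/absconv_sh/absconv_iter_sh.
  by apply: (pwsum_zero_x (r := r)) => //; [exact: absconv_iter_sh|exact: IH].
have /choice[C HC] (ij : 'I_d * 'I_d) : exists C : R, forall t, `|t| <= r / 2 ->
    `|pwsum (sh (xi ij.1) (sh (xi ij.2) c)) (dcoords p (t, x))| <= C * `|t| ^+ k.+1.
  have [|C HC] := @deriv_taylor _ (fun m t => pwsum (iter m (sh ord0)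
      (sh (xi ij.1) (sh (xi ij.2) c))) (dcoords p (t, x))) (r / 2) k.+1.
    move=> m t tr; apply: (is_derive_tseries (r := r)) => //.
      by do 2 apply: absconv_sh.
    by apply: polydisc_time => //; exact: le_lt_trans r2.
  exists C => t tr; have := HC t tr; rewrite big1 ?subr0 // => m _.
  by rewrite zeroD // !mul0r.
rewrite iterSr.
(* Side [-1]: the equation, and with it the decay of [V_t], is known only for [t < 0]. *)
apply: (@deriv_flat _ (fun m t => pwsum (iter m (sh ord0) (sh ord0 c)) (dcoords p (t, x)))
  (r / 2) (Lam * d%:R * \sum_i \sum_j C (i, j)) (r / 2) k (-1)).
- by rewrite divr_gt0.
- by rewrite divr_gt0.
- by rewrite sqrrN expr1n.
- move=> m t tr; apply: (is_derive_tseries (r := r)) => //; first exact: absconv_sh.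
  by apply: polydisc_time => //; exact: le_lt_trans r2.
- by move=> m mk; rewrite -iterSr IH.
move=> h /andP[h0 hr]; rewrite mulN1r /=.
have hn : `|- h| = h by rewrite normrN gtr0_norm.
apply: le_trans (ineq (- h, x) _ _) _.
- by apply: polydisc_time => //; rewrite hn (lt_trans hr).
- by rewrite /= oppr_lt0.
have dL := ell_ge0 lam0 FE.
rewrite -[X in _ <= X]mulrA ler_wpM2l // mulr_suml; apply: ler_sum => i _.
rewrite mulr_suml; apply: ler_sum => j _.
by have := HC (i, j) (- h); rewrite hn; apply; exact: ltW.
Qed.

(** Along the time line through the centre, the difference of the two series depends only on its
    pure time coefficients ([pwsum_axis]). *)
Lemma crepr_time_zero f g (s : R) x0 r cf cg : crepr f (s, x0) r cf -> crepr g (s, x0) r cg ->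
  (forall m, iter m (sh ord0) (fun a => cf a - cg a) (fun=> 0%N) = 0) ->
  forall t, `|t - s| < r -> t <= 0 -> f t x0 = g t x0.
Proof.
move=> [r0 caf fE] [_ cag gE] c0 t ts t0.
have tr : forall i, `|dcoords (s, x0) (t, x0) i| < r.
  apply: coordsP => [|j]; first by rewrite dcoords_t.
  by rewrite dcoords_x subrr normr0.
have [_ /= ->] := fE (t, x0) tr t0; have [_ /= ->] := gE (t, x0) tr t0.
apply/eqP; rewrite -subr_eq0 -(pwsumB r0 caf cag tr); apply/eqP.
apply: pwsum_axis c0 _; apply: coordsP => [|j _]; first by rewrite eqxx.
by rewrite dcoords_x subrr.
Qed.

(** Analytic continuation backwards in time. At the supremum [s] of the times of disagreement all
    time derivatives of the difference vanish: by hypothesis if [s = 0], otherwise because the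
    functions agree just after [s]. Agreement in a neighbourhood of [s] then contradicts the choice
    of [s]. *)
Lemma time_identity f g x0 :
  (forall t : R, -1 < t <= 0 -> exists r cf cg, crepr f (t, x0) r cf /\ crepr g (t, x0) r cg) ->
  (forall r cf cg, crepr f (0, x0) r cf -> crepr g (0, x0) r cg ->
     forall m, iter m (sh ord0) (fun a => cf a - cg a) (fun=> 0%N) = 0) ->
  forall t : R, -1 < t <= 0 -> f t x0 = g t x0.
Proof.
move=> an term t1 /andP[t10 t11]; apply: contrapT => ne.
pose A := [set t | t1 <= t <= 0 /\ f t x0 <> g t x0].
have At1 : A t1 by split=> //; rewrite lexx.
have ubA : ubound A 0 by move=> t [/andP[]].
have supA : has_sup A by split; [exists t1|exists 0].
set s := sup A.
have ts : t1 <= s by apply: sup_upper_bound.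
have s0 : s <= 0 by apply: sup_le_ub => //; exists t1.
have zA t : s < t -> t <= 0 -> f t x0 = g t x0.
  move=> st t0; apply: contrapT => net.
  have : t <= s by apply: sup_upper_bound => //; split=> //; rewrite t0 (le_trans ts) // ltW.
  by rewrite leNgt st.
have [|r [cf [cg [rf rg]]]] := an s; first by rewrite s0 (lt_le_trans t10).
have [r0 caf fE] := rf; have [_ cag gE] := rg.
pose c a := cf a - cg a; have ca : absconv c r by exact: absconvB.
have c0 : forall m, iter m (sh ord0) c (fun=> 0%N) = 0.
  have [s00|sn0] := eqVneq s 0; first by apply: (term r); rewrite -s00.
  have sneg : s < 0 by rewrite lt_neqAle sn0.
  have r2 : r / 2 < r by lra.
  pose h m (t : R) := pwsum (iter m (sh ord0) c) (dcoords (0, x0) (t, x0)).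
  suff H m : h m 0 = 0.
    by move=> m; have := H m; rewrite /h dcoords_id pwsum0.
  have pr t : `|t| < r -> forall i, `|dcoords (0, x0) (t, x0) i| < r.
    by apply: polydisc_time => i; rewrite dcoords_id normr0.
  elim/ltn_ind: m => m IH.
  (* Side [1] with constant [0]: the difference vanishes identically just after [s]. The bound [- s]
     keeps [s + t] at nonpositive times. *)
  apply: (@deriv_flat _ h (r / 2) 0 (Num.min r (- s)) m 1) => //.
  - by rewrite divr_gt0.
  - by rewrite lt_min r0 oppr_gt0.
  - by rewrite expr1n.
  - move=> k t tr; apply: (is_derive_tseries (r := r)) => //; apply: pr.
    exact: le_lt_trans r2.
  move=> t /andP[t0]; rewrite lt_min => /andP[tr tsn].
  rewrite mul1r mul0r /h /=.
  have E : dcoords (0, x0) (t, x0) = dcoords (s, x0) (s + t, x0).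
    by apply/funext; apply: coordsP => [|j]; rewrite ?dcoords_t ?dcoords_x //=; ring.
  have tr' : `|t| < r by rewrite gtr0_norm.
  have tr1 := pr t tr'; have st0 : s + t <= 0 by lra.
  rewrite (pwsumB r0 caf cag tr1) E; rewrite E in tr1.
  have [_ /= <-] := fE _ tr1 st0; have [_ /= <-] := gE _ tr1 st0.
  by rewrite zA ?subrr ?normr0 // ltrDl.
have [t At st] := sup_adherent r0 supA.
have [/andP[_ t0] net] := At; apply: net.
apply: (crepr_time_zero rf rg c0) => //.
have : t <= s by exact: sup_upper_bound.
by move: st; rewrite -/s => st tles; rewrite ler0_norm ?subr_le0 //; lra.
Qed.

End TimeLines.

(** * Parabolic scaling *)

Section Scaling.
Context {R : realType} {d : nat}.
Implicit Types (p q : R * 'rV[R]_d) (f g u : R -> 'rV[R]_d -> R).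
Implicit Types (c : ('I_d.+1 -> nat) -> R) (x : 'rV[R]_d) (r a : R).

Definition uscal a u (t : R) x : R := a ^- 2 * u (a ^+ 2 * t) (a *: x).

Definition pscal a p : R * 'rV[R]_d := (a ^+ 2 * p.1, a *: p.2).

Definition dilation a : 'I_d.+1 -> R := coords (a ^+ 2, const_mx a : 'rV[R]_d).

Lemma dcoords_scal a p q :
  dcoords (pscal a p) (pscal a q) = fun i => dilation a i * dcoords p q i.
Proof.
apply/funext; apply: coordsP => [|j].
  by rewrite !dcoords_t /dilation coords_t mulrBr.
by rewrite !dcoords_x /dilation coords_x /= !mxE mulrBr.
Qed.

Lemma sqnormZ a x : sqnorm (a *: x) = a ^+ 2 * sqnorm x.
Proof. by rewrite /sqnorm mulr_sumr; apply: eq_bigr => i _; rewrite mxE exprMn. Qed.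

Lemma B1_scal a x : 0 < a <= 1 -> B1 d x -> B1 d (a *: x).
Proof.
move=> /andP[a0 a1]; rewrite /B1 /eball /= expr1n sqnormZ => x1.
by rewrite (le_lt_trans _ x1) // ler_piMl ?sqnorm_ge0 // exprn_ile1 // ltW.
Qed.

Lemma Q1_scal a p : 0 < a <= 1 -> Q1 d p -> Q1 d (pscal a p).
Proof.
move=> a01 [/andP[p1 p0] px]; split; last exact: B1_scal.
case/andP: a01 => a0 a1 /=; apply/andP; split; last first.
  by rewrite mulr_ge0_le0 // exprn_ge0 // ltW.
have a2 : a ^+ 2 <= 1 by rewrite exprn_ile1 // ltW.
by apply: lt_le_trans p1 _; rewrite -[leLHS]mul1r ler_wnM2r.
Qed.

Lemma psrepr_scal a u p r c : 0 < a <= 1 -> psrepr u (pscal a p) r c ->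
  psrepr (uscal a u) p r (scalcoef (dilation a) (a ^- 2) c).
Proof.
move=> /andP[a0 a1] [r0 ca uE].
have D01 : forall i, 0 <= dilation a i <= 1.
  apply: coordsP => [|j]; rewrite /dilation ?coords_t ?coords_x ?mxE.
    by apply/andP; split; rewrite ?exprn_ge0 ?exprn_ile1 // ltW.
  by rewrite a1 ltW.
split=> // [|q qr q0]; first exact: absconv_scal.
have qr' i : `|dilation a i * dcoords p q i| < r.
  have /andP[D0 D1] := D01 i.
  by rewrite normrM (ger0_norm D0) (le_lt_trans _ (qr i)) // ler_piMl.
rewrite (pwsum_scal _ r0 ca qr') -dcoords_scal -uE //=.
  by move=> i; rewrite dcoords_scal.
by rewrite pmulr_rlt0 // exprn_gt0.
Qed.

Lemma monom0 (n : nat) (y : 'I_n -> R) : monom y (fun=> 0%N) = 1.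
Proof. by apply: big1 => i _; rewrite expr0. Qed.

(** The prefactor [a ^- 2] cancels the [a ^ 2] produced by one time derivative or by two space
    derivatives, so the rescaled function solves the same equation. *)
Lemma pdt_scal a u q r c : 0 < a <= 1 -> q.1 < 0 -> psrepr u (pscal a q) r c ->
  pdt (uscal a u) q.1 q.2 = pdt u (a ^+ 2 * q.1) (a *: q.2) /\
  hess (uscal a u) q.1 q.2 = hess u (a ^+ 2 * q.1) (a *: q.2).
Proof.
move=> a01 q0 ru; have rs := psrepr_scal a01 ru; case/andP: a01 => a0 _.
have a2 : a ^+ 2 != 0 by rewrite expf_neq0 // gt_eqF.
have aq0 : (pscal a q).1 < 0 by rewrite /= pmulr_rlt0 // exprn_gt0.
split.
  rewrite (psrepr_center (psrepr_pdt rs) q0) (psrepr_center (psrepr_pdt ru) aq0).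
  by rewrite sh_scal /scalcoef monom0 /dilation coords_t mulVf // !mul1r.
rewrite (psrepr_hess rs q0) (psrepr_hess ru aq0); apply/matrixP => i j.
rewrite !mxE !sh_scal /scalcoef monom0 /dilation !coords_x !mxE.
have -> : a ^- 2 * a * a = 1 by rewrite -mulrA -expr2 mulVf.
by rewrite !mul1r.
Qed.

Lemma crepr_shrink f p r c s : 0 < s -> s <= r -> crepr f p r c -> crepr f p s c.
Proof.
move=> s0 sr [r0 ca fE]; split=> //.
  by move=> rho rho0 rhos; apply: ca => //; exact: lt_le_trans sr.
by move=> q qs; apply: fE => i; exact: lt_le_trans sr.
Qed.

Lemma crepr_scal a u p r c cu : 0 < a <= 1 -> crepr u p r cu -> crepr u (pscal a p) r c ->
  crepr (uscal a u) p r (scalcoef (dilation a) (a ^- 2) c).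
Proof.
move=> a01 [_ _ uQ] [r0 ca uE].
have D01 : forall i, 0 <= dilation a i <= 1.
  case/andP: a01 => a0 a1; apply: coordsP => [|j]; rewrite /dilation ?coords_t ?coords_x ?mxE.
    by apply/andP; split; rewrite ?exprn_ge0 ?exprn_ile1 // ltW.
  by rewrite a1 ltW.
split=> // [|q qr q0]; first exact: absconv_scal.
split; first by case: (uQ q qr q0).
have qr' i : `|dilation a i * dcoords p q i| < r.
  have /andP[D0 D1] := D01 i.
  by rewrite normrM (ger0_norm D0) (le_lt_trans _ (qr i)) // ler_piMl.
rewrite (pwsum_scal _ r0 ca qr') -dcoords_scal.
have [||_ <- //] := uE (pscal a q); first by move=> i; rewrite dcoords_scal.
by rewrite /= mulr_ge0_le0 // exprn_ge0 // ltW; case/andP: a01.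
Qed.

Variables (F : 'M[R]_d -> R) (lam Lam : R) (u : R -> 'rV[R]_d -> R).
Hypotheses (lam0 : 0 <= lam) (FE : unif_elliptic F lam Lam).
Hypothesis uan : forall p, Q1 d p -> p <> (0, 0) -> exists r c, crepr u p r c.
Hypothesis upde : forall q, Q1 d q -> q.1 < 0 -> pdt u q.1 q.2 = F (hess u q.1 q.2).
Hypothesis uhom : forall a x, 0 < a -> B1 d x -> B1 d (a *: x) ->
  u 0 (a *: x) = a ^+ 2 * u 0 x.

Let an_neg p : Q1 d p -> p.1 < 0 -> exists r c, psrepr u p r c.
Proof.
move=> Qp p0; have [|r [c rc]] := uan Qp.
  by move=> E; move: p0; rewrite E ltxx.
by exists r, c; exact: crepr_psrepr.
Qed.

(** Since [x <> 0], the time line through [x] and its rescaling avoid the one point where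
    analyticity may fail. Agreement at [t = 0] is the homogeneity of the terminal slice. *)
Lemma self_similar a t x : 0 < a <= 1 -> x <> 0 -> Q1 d (t, x) -> u t x = uscal a u t x.
Proof.
move=> a01 x0 [tI xB]; have /andP[a0 a1] := a01.
apply: (@time_identity _ _ u (uscal a u) x) tI => [s sI|r cf cg rf rg].
  have Qs : Q1 d (s, x) by [].
  have [|r1 [c1 h1]] := uan Qs; first by move=> [_].
  have [|r2 [c2 h2]] := uan (Q1_scal a01 Qs).
    by move=> [_ /eqP]; rewrite scaler_eq0 gt_eqF //= => /eqP.
  have [r10 _ _] := h1; have [r20 _ _] := h2.
  have m0 : 0 < Num.min r1 r2 by rewrite lt_min r10.
  have g1 : crepr u (s, x) (Num.min r1 r2) c1.
    by apply: crepr_shrink h1 => //; rewrite ge_min lexx.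
  have g2 : crepr u (pscal a (s, x)) (Num.min r1 r2) c2.
    by apply: crepr_shrink h2 => //; rewrite ge_min lexx orbT.
  by exists (Num.min r1 r2), c1, (scalcoef (dilation a) (a ^- 2) c2); split=> //;
    exact: crepr_scal g1 g2.
apply: (terminal_flat lam0 FE rf rg upde).
  move=> q Qq q0; have Qaq := Q1_scal a01 Qq.
  have aq0 : (pscal a q).1 < 0 by rewrite /= pmulr_rlt0 // exprn_gt0.
  have [r' [c' ru]] := an_neg Qaq aq0.
  by have [-> ->] := pdt_scal a01 q0 ru; exact: (upde Qaq aq0).
move=> y [_ yB]; rewrite /uscal mulr0 uhom //; last exact: B1_scal.
by rewrite mulrA mulVf ?mul1r // expf_neq0 // gt_eqF.
Qed.

Lemma pdt_self_similar a t x : 0 < a <= 1 -> x <> 0 -> Q1 d (t, x) -> t < 0 ->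
  pdt u (a ^+ 2 * t) (a *: x) = pdt u t x.
Proof.
move=> a01 x0 Qt t0; have Qa := Q1_scal a01 Qt; have /andP[a0 a1] := a01.
have aq0 : (pscal a (t, x)).1 < 0 by rewrite /= pmulr_rlt0 // exprn_gt0.
have [r [c ru]] := an_neg Qa aq0.
have [<- _] := pdt_scal (q := (t, x)) a01 t0 ru.
rewrite /pdt /=; apply: near_eq_derive.
have [/andP[t1 _] xB] := Qt; rewrite /= in t1.
have e0 : 0 < Num.min (t + 1) (- t) by rewrite lt_min oppr_gt0 t0 andbT -ltrBlDr sub0r.
have := nbhsx_ballx t _ e0; apply: filterS => s.
rewrite /ball /= lt_min => /andP[s1 s2]; apply/esym/self_similar => //.
split=> //=; have := ler_norm (t - s); have := ler_norm (s - t); rewrite distrC.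
by move=> ? ?; apply/andP; split; lra.
Qed.

End Scaling.

(** * Liouville theorem for the time derivative *)

Lemma le_of_small {R : realType} (a b C e : R) : 0 < e ->
  (forall h : R, 0 < h < e -> a <= b + C * h) -> a <= b.
Proof.
move=> e0 H; apply/ler_addgt0Pl => eps eps0.
pose h := Num.min (e / 2) (eps / (`|C| + 1)).
have C1 : 0 < `|C| + 1 by rewrite ltr_wpDl.
have h0 : 0 < h by rewrite lt_min !divr_gt0.
have he : h < e by rewrite (@le_lt_trans _ _ (e / 2)) ?ge_min ?lexx //; lra.
have hC : h * (`|C| + 1) <= eps by rewrite -ler_pdivlMr // ge_min lexx orbT.
apply: le_trans (H h _) _; first by rewrite h0.
rewrite addrC lerD2r; apply: le_trans hC; rewrite mulrC ler_pM2l //.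
by rewrite (le_trans (ler_norm _)) // lerDl.
Qed.

Lemma mx_rearrange {R : realType} {d : nat} (M0 X S M1 Y : 'M[R]_d) :
  M0 - X + S - M1 = S - X - (M1 - M0 - Y) - Y.
Proof. by apply/matrixP => i j; rewrite !mxE; ring. Qed.

Lemma chain_psd {R : realType} (a b c qr qb S : R) :
  qr <= S -> S <= b -> qb <= a - c -> 0 <= a + b - c - qr - qb.
Proof. by lra. Qed.

(** In the application [f0] and [f1] are [F] at the Hessians of [u] at times [p.1] and [p.1 + h],
    [y] and [z] are its values at two comparison matrices, and [hW] is [h] times the time derivative
    of [w]. *)
Lemma chain_ell {R : realType} (f1 f0 z y P Q hW Ch : R) :
  - Ch <= f1 - f0 - hW -> f1 <= z -> z <= y + P -> Q <= f0 - y -> hW <= P - Q + Ch.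
Proof. by lra. Qed.

Lemma norm0_lt {R : realType} (n : nat) (r : R) : 0 < r ->
  forall i : 'I_n, `|(fun _ : 'I_n => 0 : R) i| < r.
Proof. by move=> r0 i; rewrite normr0. Qed.

(** * The linearised inequality at a touching point *)

Section InteriorMax.
Context {R : realType} {d : nat}.
Implicit Types (p q : R * 'rV[R]_d) (u : R -> 'rV[R]_d -> R).
Implicit Types (c : ('I_d.+1 -> nat) -> R) (x v : 'rV[R]_d) (r : R).

Definition dot x v : R := \sum_i x 0 i * v 0 i.

Lemma sqnorm_line x v (s : R) :
  sqnorm (x + s *: v) = sqnorm x + 2 * s * dot x v + s ^+ 2 * sqnorm v.
Proof.
rewrite /sqnorm /dot !mulr_sumr -!big_split; apply: eq_bigr => i _ /=.
by rewrite !mxE; ring.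
Qed.

Lemma qform_outer x v : (v *m (x^T *m x) *m v^T) 0 0 = dot x v ^+ 2.
Proof.
rewrite mulmxA -mulmxA mxE big_ord1 expr2 /dot !mxE; congr (_ * _).
  by apply: eq_bigr => i _; rewrite !mxE mulrC.
by apply: eq_bigr => i _; rewrite !mxE.
Qed.

Lemma qformB (M N : 'M[R]_d) v :
  (v *m (M - N) *m v^T) 0 0 = (v *m M *m v^T) 0 0 - (v *m N *m v^T) 0 0.
Proof. by rewrite mulmxBr mulmxBl !mxE. Qed.

Lemma qformZ (k : R) (M : 'M[R]_d) v :
  (v *m (k *: M) *m v^T) 0 0 = k * (v *m M *m v^T) 0 0.
Proof. by rewrite -scalemxAr -scalemxAl !mxE. Qed.

Lemma tr_outer x : \tr (x^T *m x) = sqnorm x.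
Proof.
by apply: eq_bigr => i _; rewrite !mxE big_ord1 !mxE expr2.
Qed.

Lemma dirsh2 (n : nat) (v : 'I_n -> R) (c : ('I_n -> nat) -> R) a :
  dirsh v (dirsh v c) a = \sum_i \sum_j v i * v j * sh i (sh j c) a.
Proof.
apply: eq_bigr => i _; rewrite /sh /dirsh !mulr_sumr; apply: eq_bigr => j _.
by rewrite /sh; ring.
Qed.

Lemma dirsh2_x v c :
  dirsh (coords (0, v)) (dirsh (coords (0, v)) c) (fun=> 0%N) = (v *m hcoef c *m v^T) 0 0.
Proof.
rewrite dirsh2 big_ord_recl coords_t big1 ?add0r => [|j _]; last by rewrite !mul0r.
rewrite qformE; apply: eq_bigr => i _; rewrite big_ord_recl coords_t mulr0 mul0r add0r.
by apply: eq_bigr => j _; rewrite !coords_x mxE; ring.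
Qed.

Variables (F : 'M[R]_d -> R) (lam Lam : R) (u : R -> 'rV[R]_d -> R).
Hypotheses (lam0 : 0 <= lam) (FE : unif_elliptic F lam Lam).

Variables (p : R * 'rV[R]_d) (r : R) (c : ('I_d.+1 -> nat) -> R).
Hypotheses (p0 : p.1 < 0) (ru : psrepr u p r c).
Hypothesis upde : forall q, (forall i, `|dcoords p q i| < r) -> q.1 < 0 ->
  pdt u q.1 q.2 = F (hess u q.1 q.2).

Let w := pdt u.
Let cw := sh ord0 c.
Let rw : psrepr w p r cw. Proof. exact: psrepr_pdt. Qed.

(** The cubic error is what a symmetric second difference requires: it remains negligible after
    division by [s ^ 2]. *)
Lemma w_xline v : exists2 C : R, 0 <= C & exists2 e : R, 0 < e & forall s : R, `|s| <= e ->
  `|w p.1 (p.2 + s *: v) - w p.1 p.2 - s * dirsh (coords (0, v)) cw (fun=> 0%N)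
    - s ^+ 2 / 2 * (v *m hcoef cw *m v^T) 0 0| <= C * `|s| ^+ 3.
Proof.
have [r0 ca wE] := rw.
have [|e e0 He] := polydisc_line (y := fun=> 0) (coords (0, v)) r0; first by move=> i; rewrite normr0.
pose f m (s : R) := pwsum (iter m (dirsh (coords (0, v))) cw)
   (fun i : 'I_d.+1 => 0 + s * coords (0, v) i).
have cm m : absconv (iter m (dirsh (coords (0, v))) cw) r.
  by elim: m => //= m; exact: absconv_dirsh.
have [|C HC] := @deriv_taylor _ f (e / 2) 3.
  move=> m t te; apply: (is_derive_pwsum (r := r)) => // i.
  by apply: He; apply: le_lt_trans te _; lra.
have f0 m : f m 0 = iter m (dirsh (coords (0, v))) cw (fun=> 0%N).
  by rewrite /f (_ : (fun i => _) = fun=> 0) ?pwsum0 //; apply/funext => i; rewrite mul0r addr0.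
have fw s : `|s| <= e / 2 -> f 0%N s = w p.1 (p.2 + s *: v).
  move=> se; have E : dcoords p (p.1, p.2 + s *: v) = fun i => 0 + s * coords (0, v) i.
    by have := dcoords_line p p 0 s v; rewrite dcoords_id mulr0 addr0.
  by rewrite (wE (p.1, p.2 + s *: v)) ?E //= => i; apply: He; apply: le_lt_trans se _; lra.
exists `|C| => //; exists (e / 2) => [|s se]; first by rewrite divr_gt0.
have := HC s se; rewrite !big_ord_recl big_ord0 /= !f0 /= dirsh2_x.
rewrite -(psrepr_center rw p0) fw //.
have -> : (0`!)%:R = 1 :> R by [].
have -> : ((bump 0 (bump 0 0))`!)%:R = 2 :> R by [].
rewrite /bump /= expr0 expr1.
move=> H; apply: le_trans (le_trans H _); last by rewrite ler_wpM2r ?exprn_ge0 // ler_norm.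
rewrite le_eqVlt; apply/orP; left; apply/eqP; congr `|_|.
by field.
Qed.

Lemma w_tline : exists2 C : R, 0 <= C & exists2 e : R, 0 < e & forall h : R, `|h| < e ->
  p.1 + h < 0 /\ `|w (p.1 + h) p.2 - w p.1 p.2 - h * sh ord0 cw (fun=> 0%N)| <= C * h ^+ 2.
Proof.
have [r0 ca wE] := rw.
have [K [e [e0 He]]] := pwsum_quad (y := fun=> 0) (coords (1, 0 : 'rV[R]_d)) r0 ca (norm0_lt r0).
have [e' e'0 He'] := polydisc_line (y := fun=> 0) (coords (1, 0 : 'rV[R]_d)) r0 (norm0_lt r0).
exists `|K| => //; exists (Num.min e (Num.min e' (- p.1))).
  by rewrite !lt_min e0 e'0 oppr_gt0.
move=> h; rewrite !lt_min => /and3P[h1 h2 h3].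
have ph : p.1 + h < 0 by have := ler_norm h; lra.
split=> //; apply: le_trans (le_trans (He h h1) _); last first.
  by rewrite ler_wpM2r ?sqr_ge0 // ler_norm.
rewrite !pwsum0 dirsh_t (psrepr_center rw p0).
have E : dcoords p (p.1 + h, p.2) = fun i => 0 + h * coords (1, 0 : 'rV[R]_d) i.
  by have := dcoords_line p p 1 h 0; rewrite dcoords_id mulr1 scaler0 addr0.
by rewrite (wE (p.1 + h, p.2)) ?E //=; exact: He'.
Qed.

(** Time and space derivatives of the series commute, so the time increment of the Hessian of [u]
    is, to first order, the Hessian [hcoef cw] of [w]. This stands in for differentiating the
    equation. *)
Lemma hess_tline : exists2 C : R, 0 <= C & exists2 e : R, 0 < e & forall h : R, `|h| < e ->
  p.1 + h < 0 /\ (forall i, `|dcoords p (p.1 + h, p.2) i| < r) /\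
  \sum_i \sum_j `|(hess u (p.1 + h) p.2 - hess u p.1 p.2 - h *: hcoef cw) i j| <= C * h ^+ 2.
Proof.
have [r0 ca uE] := ru.
have [e' e'0 He'] := polydisc_line (y := fun=> 0) (coords (1, 0 : 'rV[R]_d)) r0 (norm0_lt r0).
have /choice[K HK] (ij : 'I_d * 'I_d) : exists K : R, exists2 e : R, 0 < e & forall h : R, `|h| < e ->
    `|pwsum (sh (xi ij.1) (sh (xi ij.2) c)) (fun i => 0 + h * coords (1, 0 : 'rV[R]_d) i)
     - sh (xi ij.1) (sh (xi ij.2) c) (fun=> 0%N)
     - h * sh (xi ij.1) (sh (xi ij.2) cw) (fun=> 0%N)| <= K * h ^+ 2.
  have [|K [e [e0 He]]] := pwsum_quad (y := fun=> 0) (c := sh (xi ij.1) (sh (xi ij.2) c))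
    (coords (1, 0 : 'rV[R]_d)) r0 _ (norm0_lt r0); first by do 2 apply: absconv_sh.
  exists K, e => // h he; have := He h he; rewrite !pwsum0 dirsh_t.
  by rewrite (sh_comm ord0 (xi ij.1)) (sh_comm ord0 (xi ij.2)).
have /choice[e He] (ij : 'I_d * 'I_d) : exists e : R, 0 < e /\ forall h : R, `|h| < e ->
    `|pwsum (sh (xi ij.1) (sh (xi ij.2) c)) (fun i => 0 + h * coords (1, 0 : 'rV[R]_d) i)
     - sh (xi ij.1) (sh (xi ij.2) c) (fun=> 0%N)
     - h * sh (xi ij.1) (sh (xi ij.2) cw) (fun=> 0%N)| <= K ij * h ^+ 2.
  by have [e e0 He] := HK ij; exists e.
pose em := \big[Order.min/Num.min e' (- p.1)]_(ij : 'I_d * 'I_d) e ij.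
exists (\sum_i \sum_j `|K (i, j)|); first by apply: sumr_ge0 => i _; apply: sumr_ge0.
exists em => [|h hem].
  by apply/bigmin_gtP; split=> [|ij _]; [rewrite lt_min e'0 oppr_gt0|exact: (He ij).1].
move/bigmin_gtP: hem; rewrite lt_min => -[/andP[h2 h3] h1].
have ph : p.1 + h < 0 by have := ler_norm h; lra.
have E : dcoords p (p.1 + h, p.2) = fun i => 0 + h * coords (1, 0 : 'rV[R]_d) i.
  by have := dcoords_line p p 1 h 0; rewrite dcoords_id mulr1 scaler0 addr0.
have qr : forall i, `|dcoords p (p.1 + h, p.2) i| < r by move=> i; rewrite E; exact: He'.
split=> //; split=> //; rewrite mulr_suml; apply: ler_sum => i _; rewrite mulr_suml.
apply: ler_sum => j _; rewrite (psrepr_hess ru p0) !mxE.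
have [_ _ /(_ (p.1 + h, p.2) qr ph) /= ->] := psrepr_pdx i (psrepr_pdx j ru).
rewrite E; apply: le_trans ((He (i, j)).2 h (h1 _ isT)) _.
by rewrite ler_wpM2r ?sqr_ge0 // ler_norm.
Qed.

(* [w = u_t] solves the linearised equation; at a point where [w] is touched from
   above by a function of [rho = |x|^2 / (-t)] with first and second order
   coefficients [A] and [B], this forces the inequality excluded here. *)
Lemma no_interior_max (A B e : R) : 0 <= A -> 0 <= B -> 0 < e ->
  let rho q := sqnorm q.2 / (- q.1) in
  (forall q, (forall i, `|dcoords p q i| < e) -> q.1 < 0 ->
     w q.1 q.2 <= w p.1 p.2 + A * (rho q - rho p) - B * (rho q - rho p) ^+ 2) ->
  8 * lam * B * rho p <= (2 * d%:R * Lam - rho p) * A.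
Proof.
move=> A0 B0 e0 rho H; set x := p.2; set tau := - p.1.
have tau0 : 0 < tau by rewrite oppr_gt0.
have tauN : tau != 0 by rewrite gt_eqF.
(* At fixed time, [A rho] has Hessian [al] times the identity, and [B (rho - rho p) ^ 2] has Hessian
   [be] times [x^T *m x] at the point [x]. *)
pose al := 2 * A / tau; pose be := 8 * B / tau ^+ 2.
have al0 : 0 <= al by rewrite divr_ge0 ?mulr_ge0 // ltW.
have be0 : 0 <= be by apply: divr_ge0; [rewrite mulr_ge0|rewrite sqr_ge0].
have rp : rho p = sqnorm x / tau by [].
(* Adding the touching inequality at [s] and at [- s] cancels the first-order term; division by
   [s ^ 2] leaves the second derivative up to [O(s)]. *)
have qf v : (v *m hcoef cw *m v^T) 0 0 <= al * sqnorm v - be * dot x v ^+ 2.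
  have [C C0 [e1 e10 HC]] := w_xline v.
  have [e2 e20 He2] := polydisc_line (y := fun=> 0) (coords (0, v)) e0 (norm0_lt e0).
  apply: (@le_of_small _ _ _ (2 * C) (Num.min e1 e2)); first by rewrite lt_min e10.
  move=> s /andP[s0]; rewrite lt_min => /andP[s1 s2].
  have E (k : R) : dcoords p (p.1, x + k *: v) = fun i => 0 + k * coords (0, v) i.
    by have := dcoords_line p p 0 k v; rewrite dcoords_id mulr0 addr0.
  have Hs (k : R) : `|k| < e2 -> w p.1 (x + k *: v) <= w p.1 x +
      A * ((2 * k * dot x v + k ^+ 2 * sqnorm v) / tau)
      - B * ((2 * k * dot x v + k ^+ 2 * sqnorm v) / tau) ^+ 2.
    move=> ke; have := H (p.1, x + k *: v); rewrite /= E => /(_ (He2 k ke) p0).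
    have -> : rho (p.1, x + k *: v) - rho p = (2 * k * dot x v + k ^+ 2 * sqnorm v) / tau.
      by rewrite /rho /= sqnorm_line -mulrBl; congr (_ / _); rewrite -/x; ring.
    by [].
  have h1 := Hs s; have h2 := Hs (- s); have h3 := HC s; have h4 := HC (- s).
  move: h1 h2 h3 h4; rewrite normrN (gtr0_norm s0) -/x => /(_ s2) h1 /(_ s2) h2.
  move=> /(_ (ltW s1)) h3 /(_ (ltW s1)) h4; move: h3 h4; rewrite !ler_norml sqrrN.
  set q := ((v *m _ *m _) 0 0); set D := dirsh _ _ _.
  move=> /andP[h3 _] /andP[h4 _].
  have sq : s ^+ 2 * q <= s ^+ 2 * (al * sqnorm v - be * dot x v ^+ 2 + 2 * C * s).
    have N4 : 0 <= 2 * B * (s ^+ 2 * sqnorm v / tau) ^+ 2.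
      by rewrite mulr_ge0 ?sqr_ge0 // mulr_ge0.
    have I1 : A * ((2 * s * dot x v + s ^+ 2 * sqnorm v) / tau)
      - B * ((2 * s * dot x v + s ^+ 2 * sqnorm v) / tau) ^+ 2 +
      (A * ((2 * - s * dot x v + (- s) ^+ 2 * sqnorm v) / tau)
      - B * ((2 * - s * dot x v + (- s) ^+ 2 * sqnorm v) / tau) ^+ 2) =
      s ^+ 2 * (al * sqnorm v - be * dot x v ^+ 2) - 2 * B * (s ^+ 2 * sqnorm v / tau) ^+ 2.
      by rewrite /al /be; field.
    move: I1 N4; rewrite sqrrN.
    set X1 := A * _; set X2 := B * _ ^+ 2; set X3 := A * _; set X4 := B * _ ^+ 2.
    have -> : s ^+ 2 * (al * sqnorm v - be * dot x v ^+ 2 + 2 * C * s) =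
      s ^+ 2 * (al * sqnorm v - be * dot x v ^+ 2) + 2 * (C * s ^+ 3) by ring.
    rewrite sqrrN in h2; rewrite -/X3 -/X4 in h2; rewrite -/X1 -/X2 in h1.
    move: (X1) (X2) (X3) (X4) h1 h2 => Y1 Y2 Y3 Y4 h1 h2.
    set W1 := w p.1 (x + s *: v) in h1 h3 *; set W2 := w p.1 (x + - s *: v) in h2 h4 *.
    lra.
  by move: sq; rewrite ler_pM2l // exprn_gt0.
have wt_ge : A * rho p / tau <= sh ord0 cw (fun=> 0%N).
  have [C C0 [e1 e10 HC]] := w_tline.
  have [e2 e20 He2] := polydisc_line (y := fun=> 0) (coords (1, 0 : 'rV[R]_d)) e0 (norm0_lt e0).
  apply: (@le_of_small _ _ _ (C + A * rho p / tau ^+ 2) (Num.min e1 e2)).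
    by rewrite lt_min e10.
  move=> h /andP[h0]; rewrite lt_min => /andP[h1 h2].
  have [|ph] := HC (- h); first by rewrite normrN gtr0_norm.
  rewrite sqrrN ler_norml => /andP[h3 _].
  have E : dcoords p (p.1 - h, x) = fun i => 0 + - h * coords (1, 0 : 'rV[R]_d) i.
    by have := dcoords_line p p 1 (- h) 0; rewrite dcoords_id mulr1 scaler0 addr0.
  have := H (p.1 - h, x); rewrite E /= => /(_ (He2 _ _) ph).
  rewrite normrN gtr0_norm // => /(_ h2).
  have th : tau + h != 0 by rewrite gt_eqF // addr_gt0.
  have -> : rho (p.1 - h, x) - rho p = - (rho p * h / (tau + h)).
    rewrite /rho /= -/x -/tau; have -> : - (p.1 - h) = tau + h by rewrite /tau; ring.
    by field; rewrite tauN th.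
  move=> h4.
  have rp0 : 0 <= rho p by rewrite rp divr_ge0 ?sqnorm_ge0 // ltW.
  have h5 : w (p.1 - h) x <= w p.1 x - A * (rho p * h / (tau + h)).
    apply: le_trans h4 _; rewrite -/x mulrN lerBlDr lerDl mulr_ge0 // sqr_ge0 //.
  have h6 : A * rho p * h * (tau^-1 - h / tau ^+ 2) <= A * (rho p * h / (tau + h)).
    have -> : A * (rho p * h / (tau + h)) = A * rho p * h * (tau + h)^-1.
      by rewrite !mulrA.
    apply: ler_wpM2l; first by rewrite mulr_ge0 ?(ltW h0) // mulr_ge0.
    rewrite -subr_ge0.
    have -> : (tau + h)^-1 - (tau^-1 - h / tau ^+ 2) = h ^+ 2 / (tau ^+ 2 * (tau + h)).
      by field; rewrite tauN th.
    by rewrite divr_ge0 ?sqr_ge0 // mulr_ge0 ?sqr_ge0 // addr_ge0 // ltW.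
  have h7 : h * (A * rho p / tau) <= h * (sh ord0 cw (fun=> 0%N) + (C + A * rho p / tau ^+ 2) * h).
    move: h3 h5 h6; rewrite -/x; set W := sh _ _ _.
    have -> : A * rho p * h * (tau^-1 - h / tau ^+ 2) =
      h * (A * rho p / tau) - h * (A * rho p / tau ^+ 2 * h) by ring.
    have -> : h * (W + (C + A * rho p / tau ^+ 2) * h) =
      h * W + C * h ^+ 2 + h * (A * rho p / tau ^+ 2 * h) by ring.
    rewrite mulNr; lra.
  by move: h7; rewrite ler_pM2l.
(* With [X = h be x^T x], the Hessian at time [p.1 + h] is at most [M0 - X + (h al + K h ^ 2) I].
   The constant [Lam] prices the multiple of the identity, and [lam] measures the gain from [X],
   whose trace is [h be |x| ^ 2]. *)
have wt_le : sh ord0 cw (fun=> 0%N) <= Lam * d%:R * al - lam * be * sqnorm x.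
  have [C C0 [e1 e10 HC]] := w_tline; have [K K0 [e2 e20 HK]] := hess_tline.
  apply: (@le_of_small _ _ _ (C + Lam * d%:R * K) (Num.min e1 e2)); first by rewrite lt_min e10.
  move=> h /andP[h0]; rewrite lt_min => /andP[h1 h2].
  have hn : `|h| = h by rewrite gtr0_norm.
  have [|ph] := HC h; first by rewrite hn.
  rewrite ler_norml => /andP[h3 _].
  have [|_ [hr]] := HK h; first by rewrite hn.
  set M0 := hess u p.1 p.2; set M1 := hess u (p.1 + h) p.2 => hR.
  have r0 : 0 < r by case: ru.
  have pr : forall i, `|dcoords p p i| < r by move=> i; rewrite dcoords_id normr0.
  have w0 : w p.1 p.2 = F M0 by exact: upde.
  have w1 : w (p.1 + h) p.2 = F M1 by exact: (upde hr ph).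
  have s0 : symmetric_mx M0 by rewrite /M0 (psrepr_hess ru p0); exact: hcoef_sym.
  have s1 : symmetric_mx M1.
    apply/matrixP => i j; rewrite !mxE.
    have [_ _ /(_ _ hr ph) /= ->] := psrepr_pdx i (psrepr_pdx j ru).
    by have [_ _ /(_ _ hr ph) /= ->] := psrepr_pdx j (psrepr_pdx i ru); rewrite sh_comm.
  pose X := (h * be) *: (x^T *m x).
  have sX : symmetric_mx X by rewrite /symmetric_mx /X linearZ /= trmx_mul trmxK.
  have pX : psd_mx X.
    move=> v; rewrite qformZ qform_outer.
    by rewrite mulr_ge0 ?sqr_ge0 // mulr_ge0 // ltW.
  have k0 : 0 <= h * al + K * h ^+ 2.
    by rewrite addr_ge0 // mulr_ge0 ?sqr_ge0 // ltW.
  have sMX : symmetric_mx (M0 - X) by exact: symB.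
  have F1 : F M1 <= F (M0 - X + (h * al + K * h ^+ 2)%:M).
    apply: (ell_mono lam0 FE) => //; first exact: symD sMX (sym_scalar _).
    move=> v.
    have -> : M0 - X + (h * al + K * h ^+ 2)%:M - M1 =
      (h * al + K * h ^+ 2)%:M - X - (M1 - M0 - h *: hcoef cw) - h *: hcoef cw.
      by apply: mx_rearrange.
    rewrite (qformB _ (h *: hcoef cw)) (qformB _ (M1 - M0 - _)) (qformB _ X).
    rewrite qform_scalar /X !qformZ qform_outer.
    have b1 := qform_bound (M1 - M0 - h *: hcoef cw) v.
    have b2 : (\sum_i \sum_j `|(M1 - M0 - h *: hcoef cw) i j|) * sqnorm v <= K * h ^+ 2 * sqnorm v.
      by rewrite ler_wpM2r ?sqnorm_ge0.
    have b3 : h * (v *m hcoef cw *m v^T) 0 0 <= h * (al * sqnorm v - be * dot x v ^+ 2).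
      by rewrite ler_wpM2l ?qf // ltW.
    have b3' : h * (v *m hcoef cw *m v^T) 0 0 <= h * al * sqnorm v - h * be * dot x v ^+ 2.
      by move: b3; rewrite mulrBr !mulrA.
    rewrite mulrDl; exact: (chain_psd b1 b2 b3').
  have F2 := ell_scalar FE sMX k0.
  have [F3 _] := FE sMX sX pX; move: F3; rewrite subrK /X mxtraceZ tr_outer -/X => F3.
  have h7 : h * sh ord0 cw (fun=> 0%N) <=
      h * (Lam * d%:R * al - lam * be * sqnorm x + (C + Lam * d%:R * K) * h).
    move: h3; rewrite w0 w1 => h3.
    have -> : h * (Lam * d%:R * al - lam * be * sqnorm x + (C + Lam * d%:R * K) * h) =
      Lam * (d%:R * (h * al + K * h ^+ 2)) - lam * (h * be * sqnorm x) + C * h ^+ 2 by ring.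
    exact: (chain_ell h3 F1 F2 F3).
  by move: h7; rewrite ler_pM2l.
have := le_trans wt_ge wt_le; rewrite /al /be => H8.
have : tau * (A * rho p / tau) <= tau * (Lam * d%:R * (2 * A / tau) - lam * (8 * B / tau ^+ 2) * sqnorm x).
  by rewrite ler_pM2l.
have -> : tau * (A * rho p / tau) = A * rho p by field.
have -> : tau * (Lam * d%:R * (2 * A / tau) - lam * (8 * B / tau ^+ 2) * sqnorm x) =
   Lam * d%:R * 2 * A - 8 * lam * B * rho p by rewrite rp; field.
move=> H9.
have -> : (2 * d%:R * Lam - rho p) * A = Lam * d%:R * 2 * A - A * rho p by ring.
lra.
Qed.

End InteriorMax.

Section Barrier.
Context {R : realType}.

(* In the variable [rho = |x|^2 / (-t)] this is a strict supersolution of the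
   linearised equation away from [rho = 0], and it is unbounded at infinity. *)
Definition barrier (k c rho : R) : R := c * rho - expR (- (k * rho)).

(** Square [1 + z / 2 <= exp (z / 2)]; the range of [z] keeps the left side nonnegative. *)
Lemma expR_ge_sqr (z : R) : -2 <= z -> (1 + z / 2) ^+ 2 <= expR z.
Proof.
move=> z2; have -> : z = z / 2 + z / 2 by field.
rewrite expRD -expr2; have -> : (z / 2 + z / 2) / 2 = z / 2 by field.
have z1 : 0 <= 1 + z / 2 by lra.
by rewrite lerXn2r ?nnegrE ?expR_ge0 // expR_ge1Dx.
Qed.

Lemma barrier_le (k c rho eta : R) : k * eta <= 2 ->
  barrier k c (rho + eta) <= barrier k c rho
    + (c + k * expR (- (k * rho))) * eta - k ^+ 2 / 4 * expR (- (k * rho)) * eta ^+ 2.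
Proof.
move=> ke; rewrite /barrier.
have -> : - (k * (rho + eta)) = - (k * rho) + - (k * eta) by ring.
rewrite expRD; set E := expR (- (k * rho)).
have E0 : 0 <= E by exact: expR_ge0.
have := @expR_ge_sqr (- (k * eta)); rewrite lerN2 => /(_ ke).
rewrite -(subr_ge0 (_ ^+ 2)) => H; have := mulr_ge0 E0 H.
set X := expR _ => H'.
have -> : c * (rho + eta) - E * X = c * rho - E + (c + k * E) * eta
  - k ^+ 2 / 4 * E * eta ^+ 2 - E * (X - (1 + - (k * eta) / 2) ^+ 2) by field.
by rewrite lerBlDr lerDl.
Qed.

Lemma barrier_ge (k c rho : R) : 0 <= k * rho -> c * rho - 1 <= barrier k c rho.
Proof. by move=> kr; rewrite /barrier lerD2l lerN2 expR_le1 oppr_le0. Qed.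

End Barrier.

Lemma chain_touch {R : realType} (a b p c X : R) :
  a - b <= p - c -> b <= X -> a <= p + X - c.
Proof. by lra. Qed.

Section Topology.
Context {R : realType} {d : nat}.
Implicit Types (p q : R * 'rV[R]_d) (x : 'rV[R]_d).

Lemma nbhs_polydisc p (A : set (R * 'rV[R]_d)) : nbhs p A ->
  exists2 e : R, 0 < e & forall q, (forall i, `|dcoords p q i| < e) -> A q.
Proof.
move=> /nbhs_ballP[e /= e0 HA]; exists e => // q qe; apply: HA; split=> /=.
  by have := qe ord0; rewrite dcoords_t distrC.
split=> // i j; rewrite ord1; have := qe (xi j).
by rewrite dcoords_x distrC.
Qed.

Lemma sqnorm_continuous : continuous (@sqnorm R d).
Proof.
apply: continuous_sum_seq => i x.
have cx : {for x, continuous (fun y : 'rV[R]_d => y 0 i)} by exact: coord_continuous.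
have E : (fun y : 'rV[R]_d => y 0 i ^+ 2) = (fun y => y 0 i * y 0 i).
  by apply/funext => y; rewrite expr2.
by rewrite E; exact: (cvgM cx cx).
Qed.

Lemma sphere_compact (s : R) : s <= 1 -> compact [set x : 'rV[R]_d | sqnorm x = s].
Proof.
move=> s1; apply: (@subclosed_compact _ _ 
  [set x : 'rV[R]_d | forall i, `[-1, 1]%classic (x ord0 i)]).
- rewrite (_ : [set x | _] = @sqnorm R d @^-1` [set s]) //.
  apply: closed_comp; last exact: closed_eq.
  by move=> x _; exact: sqnorm_continuous.
- exact: (@rV_compact R d (fun=> `[-1, 1]%classic) (fun=> @segment_compact R (-1) 1)).
move=> x /= xs i; have -> : ord0 = 0 :> 'I_1 by []; rewrite in_itv /= -ler_norml.
have : x 0 i ^+ 2 <= 1.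
  apply: le_trans s1; rewrite -xs /sqnorm (bigD1 i) //= lerDl.
  by apply: sumr_ge0 => j _; exact: sqr_ge0.
by move=> H; rewrite -(@ler_pXn2r _ 2) ?nnegrE // expr1n real_normK ?num_real.
Qed.

Lemma exists_sqnorm (s : R) : (0 < d)%N -> 0 <= s -> exists x : 'rV[R]_d, sqnorm x = s.
Proof.
move=> d0 s0; pose i0 := Ordinal d0; exists (Num.sqrt s *: delta_mx 0 i0).
rewrite sqnormZ sqr_sqrtr // /sqnorm (bigD1 i0) //= mxE !eqxx expr1n.
rewrite big1 ?addr0 ?mulr1 // => i /negbTE ii; by rewrite mxE eqxx ii expr0n.
Qed.

Definition prho p : R := sqnorm p.2 / - p.1.

Lemma prho_continuous p : p.1 < 0 -> {for p, continuous prho}.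
Proof.
move=> p0; apply: cvgM.
  apply: (@cvg_comp _ _ _ snd (@sqnorm R d)); first exact: cvg_snd.
  exact: sqnorm_continuous.
apply: cvgV; first by rewrite oppr_eq0 lt_eqF.
by apply: cvgN; exact: cvg_fst.
Qed.

Lemma sqnorm_eq0 x : sqnorm x = 0 -> x = 0.
Proof.
move=> /eqP; rewrite psumr_eq0 => [/allP H|i _]; last exact: sqr_ge0.
apply/rowP => i; rewrite mxE; apply/eqP.
by have := H i (mem_index_enum _); rewrite sqrf_eq0.
Qed.

Lemma sqnorm0 : sqnorm (0 : 'rV[R]_d) = 0.
Proof. by apply: big1 => i _; rewrite mxE expr0n. Qed.

End Topology.

(** * Maximum principle on scaling classes *)

Section MaxPrinciple.
Context {R : realType} {d : nat}.
Implicit Types (p q : R * 'rV[R]_d) (x : 'rV[R]_d).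
Variables (F : 'M[R]_d -> R) (lam Lam : R) (u : R -> 'rV[R]_d -> R).
Hypotheses (d0 : (0 < d)%N) (lam0 : 0 < lam) (lamLam : lam <= Lam) (FE : unif_elliptic F lam Lam).
Hypothesis uan : forall p, Q1 d p -> p <> (0, 0) -> exists r c, psrepr u p r c.
Hypothesis upde : forall q, Q1 d q -> q.1 < 0 -> pdt u q.1 q.2 = F (hess u q.1 q.2).
Let w := pdt u.
Hypothesis wself : forall a t x, 0 < a <= 1 -> x <> 0 -> Q1 d (t, x) -> t < 0 ->
  w (a ^+ 2 * t) (a *: x) = w t x.

Let an_neg p : Q1 d p -> p.1 < 0 -> exists r c, psrepr u p r c.
Proof. by move=> Qp p0; apply: uan Qp _ => E; move: p0; rewrite E ltxx. Qed.

Lemma w_continuous p : Q1 d p -> p.1 < 0 ->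
  {for p, continuous (fun q : R * 'rV[R]_d => w q.1 q.2)}.
Proof.
by move=> Qp p0; have [r [c ru]] := an_neg Qp p0; exact: psrepr_cont (psrepr_pdt ru) p0.
Qed.

(** The scaling factor [a] may exceed [1]; then [wself] is applied at the image point with the
    inverse factor. The condition [s < prho q] puts the image at a time after [-1]. *)
Lemma to_sphere q (s : R) : Q1 d q -> q.1 < 0 -> 0 < prho q -> 0 < s < 1 -> s < prho q ->
  exists q', [/\ Q1 d q', sqnorm q'.2 = s, q'.1 = - (s / prho q) & w q'.1 q'.2 = w q.1 q.2].
Proof.
move=> Qq q0 rq /andP[s0 s1] srq.
have sq : 0 < sqnorm q.2 by move: rq; rewrite /prho pmulr_lgt0 // invr_gt0 oppr_gt0.
pose a := Num.sqrt (s / sqnorm q.2).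
have a0 : 0 < a by rewrite sqrtr_gt0 divr_gt0.
have a2 : a ^+ 2 = s / sqnorm q.2 by rewrite sqr_sqrtr // divr_ge0 // ltW.
have q1N : q.1 != 0 by rewrite lt_eqF.
have sqN : sqnorm q.2 != 0 by rewrite gt_eqF.
have E1 : a ^+ 2 * q.1 = - (s / prho q).
  by rewrite a2 /prho; field; rewrite q1N sqN.
have E2 : sqnorm (a *: q.2) = s by rewrite sqnormZ a2 divfK.
have Q' : Q1 d (a ^+ 2 * q.1, a *: q.2).
  split; last by rewrite /B1 /eball /= E2 expr1n.
  rewrite /= E1 ltrN2 ltr_pdivrMr // mul1r srq /= oppr_le0 divr_ge0 // ltW //.
exists (a ^+ 2 * q.1, a *: q.2); split=> //=.
have x0 : q.2 <> 0 by move=> E; move: sq; rewrite E sqnorm0 ltxx.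
have Qq' : Q1 d (q.1, q.2) by rewrite -surjective_pairing.
have [a1|a1] := leP a 1; first by apply: wself => //; rewrite a0.
have aN : a != 0 by rewrite gt_eqF.
have := @wself a^-1 (a ^+ 2 * q.1) (a *: q.2).
rewrite invr_gt0 a0 invf_le1 // (ltW a1) => /(_ isT) H.
rewrite -H //.
- by rewrite mulrA -exprMn mulVf // expr1n mul1r scalerA mulVf // scale1r.
- by move=> /eqP; rewrite scaler_eq0 (negbTE aN) /= => /eqP.
- by rewrite pmulr_rlt0 // exprn_gt0.
Qed.

Section Level.
Variable (delta : R).
Hypotheses (delta0 : 0 < delta) (delta1 : delta < 1).
(** On the sphere of squared radius [s], the level [rho = delta] is reached exactly at
    [t = -1/2]. *)
Let s := delta / 2.
Let L := 2 * d%:R * Lam.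
(** For [rho >= delta] this gives [lam k rho >= L + 1], so the concavity of the barrier outweighs
    the term with factor [L - rho]. *)
Let k := (L + 1) / (lam * delta).
(** Small enough that [c <= k exp (- k rho)] for [rho <= L], yet positive, so that the barrier is
    unbounded. *)
Let c := k * expR (- (L * k)).
Let Psi (e : R) q := w q.1 q.2 - e * barrier k c (prho q).

Let s0 : 0 < s. Proof. by rewrite divr_gt0. Qed.
Let sd : s < delta. Proof. by rewrite /s; have := delta0; lra. Qed.
Let s1 : s < 1. Proof. by rewrite /s; have := delta1; lra. Qed.
Let L0 : 0 <= L.
Proof. by rewrite !mulr_ge0 // (le_trans (ltW lam0)). Qed.
Let k0 : 0 < k.
Proof. by rewrite divr_gt0 ?mulr_gt0 // ltr_wpDl. Qed.
Let c0 : 0 < c.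
Proof. by rewrite mulr_gt0 ?expR_gt0. Qed.

Let Q1_sphere (t : R) x : - 2^-1 <= t <= 0 -> sqnorm x = s -> Q1 d (t, x).
Proof.
move=> /andP[t1 t0] xs; split; last by rewrite /B1 /eball /= xs expr1n.
by rewrite /= t0 andbT; lra.
Qed.

(** Points of the sphere at [t = 0] are covered too: they differ from the origin, so the series
    there bounds [w] at nearby negative times. Compactness of [[-1/2, 0]] times the sphere makes the
    bound uniform. *)
Lemma w_bounded_above : exists M : R, forall (t : R) x, - 2^-1 <= t < 0 -> sqnorm x = s ->
  w t x <= M.
Proof.
pose K : set (R * 'rV[R]_d) :=
  (`[- 2^-1, 0]%classic : set R) `*` [set x : 'rV[R]_d | sqnorm x = s].
have Kc : compact K.
  by apply: compact_setX; [exact: segment_compact|apply: sphere_compact; exact: ltW].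
have /compact_near_coveringP H := Kc.
have cover p : K p ->
    \forall q \near p & N \near +oo, (fun N q => q.1 < 0 -> w q.1 q.2 <= N) N q.
  case: p => t x [/=]; rewrite in_itv /= => tI xs.
  have [|r [cc ru]] := uan (Q1_sphere tI xs).
    by move=> [_ E]; move: s0; rewrite -xs E sqnorm0 ltxx.
  have [M M0 HM] := psrepr_bounded (psrepr_pdt ru); have [r0 _ _] := ru.
  exists ([set q | forall i, `|dcoords (t, x) q i| < r / 2], [set N | M <= N]) => /=.
    split; first by apply: polydisc_nbhs; rewrite divr_gt0.
    by apply: nbhs_pinfty_ge; exact: num_real.
  move=> [q N] [/= qr MN] q0; apply: le_trans MN; apply: le_trans (ler_norm _) _.
  by apply: HM => // i; exact: ltW.
have [M [_ HM]] := H R (pinfty_nbhs R) _ _ cover.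
exists (M + 1) => t x /andP[t1 t0] xs; apply: (HM (M + 1) _ (t, x)) => //.
  by rewrite ltrDl.
by split=> //=; rewrite in_itv /= t1 ltW.
Qed.

(** As [t -> 0] on the sphere, [rho -> +oo] and the barrier outgrows the bound on [w]; the maximum
    is therefore attained on a compact part [t <= - kap]. *)
Lemma Psi_max (e : R) : 0 < e -> exists p, [/\ Q1 d p, sqnorm p.2 = s, - 2^-1 <= p.1 < 0 &
  forall q, sqnorm q.2 = s -> - 2^-1 <= q.1 < 0 -> Psi e q <= Psi e p].
Proof.
move=> e0; have [M HM] := w_bounded_above.
have [x0 x0s] := exists_sqnorm d0 (ltW s0).
pose v0 := Psi e (- 2^-1, x0).
(* For [rho >= N] the value of [Psi] is below the reference value [v0]; [kap] is chosen so that
   times after [- kap] have [rho >= N]. *)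
pose N := (`|M - v0 + e| + 1) / (e * c).
have N0 : 0 < N by apply: divr_gt0; [rewrite ltr_wpDl|rewrite mulr_gt0].
pose kap := Num.min (2^-1) (s / N).
have kap0 : 0 < kap by rewrite lt_min divr_gt0 // invr_gt0 ltr0n.
pose K : set (R * 'rV[R]_d) := (`[- 2^-1, - kap]%classic : set R) `*` [set x : 'rV[R]_d | sqnorm x = s].
have Kc : compact K.
  by apply: compact_setX; [exact: segment_compact|apply: sphere_compact; exact: ltW].
have K0 : K (- 2^-1, x0).
  by split=> //=; rewrite in_itv /= lexx lerN2 ge_min lexx.
have KQ q : K q -> Q1 d q /\ q.1 < 0.
  move=> [/=]; rewrite in_itv /= => /andP[q1 q2] qs.
  have q0 : q.1 < 0 by lra.
  by split=> //; rewrite (surjective_pairing q); apply: Q1_sphere => //; rewrite q1 ltW.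
have Pc : {within K, continuous (Psi e)}.
  apply: continuous_in_subspaceT => q; rewrite inE => /KQ[Qq q0].
  apply: cvgB; first exact: w_continuous.
  apply: cvgMr; apply: cvgB; first by apply: cvgMr; exact: prho_continuous.
  apply: (@cvg_comp _ _ _ (fun q => - (k * prho q)) expR); last exact: continuous_expR.
  by apply: cvgN; apply: cvgMr; exact: prho_continuous.
have [p + Hp] := compact_EVT_max (ex_intro _ _ K0) Kc Pc.
rewrite inE => Kp; have [Qp p0] := KQ _ Kp; have [/= + ps] := Kp.
rewrite in_itv /= => /andP[p1 p2].
exists p; split=> //; first by rewrite p1.
move=> q qs /andP[q1 q0]; have [qk|qk] := leP q.1 (- kap).
  by apply: Hp; rewrite inE; split=> //=; rewrite in_itv /= q1.
apply: le_trans (Hp (- 2^-1, x0) _); last by rewrite inE.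
rewrite -/v0 /Psi; have rq : N <= prho q.
  rewrite /prho qs ler_pdivlMr ?oppr_gt0 // mulrC -ler_pdivlMr //.
  by rewrite lerNl; apply: ltW; apply: le_lt_trans qk; rewrite lerN2 ge_min lexx orbT.
have wM : w q.1 q.2 <= M by apply: HM => //; rewrite q1.
have kr : 0 <= k * prho q by rewrite mulr_ge0 ?(ltW k0) // (le_trans (ltW N0)).
have b1 : e * (c * N - 1) <= e * barrier k c (prho q).
  rewrite ler_pM2l //; apply: le_trans (barrier_ge _ kr).
  by rewrite lerD2r ler_pM2l.
have b2 : e * (c * N - 1) = `|M - v0 + e| + 1 - e.
  by rewrite /N; field; rewrite !gt_eqF.
by have := ler_norm (M - v0 + e); lra.
Qed.

(* The maximum sits on the lower level [rho = delta]: elsewhere the barrier would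
   violate [no_interior_max]. *)
Lemma Psi_max_level (e : R) : 0 < e -> exists2 x, sqnorm x = s &
  forall q, Q1 d q -> q.1 < 0 -> delta <= prho q ->
    Psi e q <= w (- 2^-1) x - e * barrier k c delta.
Proof.
move=> e0; have [p [Qp ps /andP[p1 p0] Hp]] := Psi_max e0.
have rp : prho p = s / - p.1 by rewrite /prho ps.
(* Both [w] and [prho] are scale invariant, so the maximum on the sphere is a maximum over all of
   [rho >= delta], hence over a full neighbourhood of [p] when [prho p > delta]. *)
have sphere q : Q1 d q -> q.1 < 0 -> delta <= prho q -> Psi e q <= Psi e p.
  move=> Qq q0 dq; have rq : 0 < prho q by exact: lt_le_trans dq.
  have srq : s < prho q by exact: lt_le_trans sd dq.
  have [|q' [Qq' qs' t' ww]] := to_sphere (s := s) Qq q0 rq _ srq; first by rewrite s0.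
  have rr : prho q' = prho q.
    by rewrite {1}/prho qs' t' opprK invf_div mulrCA divff ?mulr1 // gt_eqF.
  rewrite (_ : Psi e q = Psi e q'); first apply: Hp => //.
    rewrite t' oppr_lt0 divr_gt0 // andbT lerN2 ler_pdivrMr //.
    by move: dq; rewrite /s; lra.
  by rewrite /Psi ww rr.
have [pd|pd] := leP (prho p) delta; last first.
  exfalso.
  have [e1 e10 He1] := Q1_polydisc Qp.
  have [r [cc ru]] := an_neg Qp p0.
  have [r0 ca uE] := ru.
  have ru' : psrepr u p (Num.min r e1) cc.
    split; first by rewrite lt_min r0.
      by move=> rho rho0; rewrite lt_min => /andP[rhor _]; exact: ca.
    by move=> q qr; apply: uE => i; have := qr i; rewrite lt_min => /andP[].
  set E := expR (- (k * prho p)); have E0 : 0 < E by exact: expR_gt0.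
  pose A := e * (c + k * E); pose B := e * (k ^+ 2 / 4 * E).
  have kE0 : 0 < k * E by rewrite mulr_gt0.
  have A0 : 0 <= A.
    by apply: mulr_ge0; [exact: ltW|apply: addr_ge0; exact: ltW].
  have B0 : 0 <= B.
    apply: mulr_ge0; [exact: ltW|apply: mulr_ge0; [|exact: ltW]].
    by apply: divr_ge0; [exact: sqr_ge0|].
  have rc := prho_continuous p0.
  have k20 : 0 < 2 / k by rewrite divr_gt0.
  have : nbhs p [set q | delta < prho q /\ `|prho p - prho q| < 2 / k].
    apply: filterI.
      have dp : 0 < prho p - delta by rewrite subr_gt0.
      move/cvgrPdist_lt: (rc) => /(_ _ dp); apply: filterS => q /=.
      by move=> /(le_lt_trans (ler_norm _)); lra.
    by move/cvgrPdist_lt: rc => /(_ _ k20).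
  move=> /nbhs_polydisc[e2 e20 He2].
  have upde' q : (forall i, `|dcoords p q i| < Num.min r e1) -> q.1 < 0 ->
      pdt u q.1 q.2 = F (hess u q.1 q.2).
    move=> qr q0; apply: upde => //; apply: He1 (ltW q0) => i.
    by have := qr i; rewrite lt_min => /andP[].
  have := @no_interior_max _ _ F lam Lam u (ltW lam0) FE p _ cc p0 ru' upde' A B (Num.min e1 e2) A0 B0.
  rewrite lt_min e10 e20 => /(_ isT) /= H.
  have {H} : 8 * lam * B * prho p <= (2 * d%:R * Lam - prho p) * A.
    apply: H => q qe q0.
    have Qq : Q1 d q.
      by apply: He1 (ltW q0) => i; have := qe i; rewrite lt_min => /andP[].
    have [dq qk] : delta < prho q /\ `|prho p - prho q| < 2 / k.
      by apply: He2 => i; have := qe i; rewrite lt_min => /andP[].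
    have := sphere q Qq q0 (ltW dq); rewrite /Psi -/(prho q) -/(prho p).
    have ke : k * (prho q - prho p) <= 2.
      rewrite mulrC -ler_pdivlMr //; apply: ltW; apply: le_lt_trans qk.
      by rewrite distrC ler_norm.
    have := barrier_le c (prho p) ke; rewrite [prho p + _]addrC subrK -/E => b.
    have := ler_wpM2l (ltW e0) b; rewrite /A /B => b'.
    have -> : w p.1 p.2 + e * (c + k * E) * (prho q - prho p) -
      e * (k ^+ 2 / 4 * E) * (prho q - prho p) ^+ 2 =
      w p.1 p.2 + e * (barrier k c (prho p) + (c + k * E) * (prho q - prho p)
       - k ^+ 2 / 4 * E * (prho q - prho p) ^+ 2) - e * barrier k c (prho p) by ring.
    by move=> h; exact: (chain_touch h b').
  (* The inequality to refute is [2 (lam k rho) k E <= (L - rho) (c + k E)]. For [rho >= L] the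
     right side is nonpositive; for [rho < L] it is at most [2 L k E] because [c <= k E], while the
     left side is at least [2 (L + 1) k E]. *)
  rewrite -/L /A /B leNgt => /negP; apply.
  have -> : (L - prho p) * (e * (c + k * E)) = e * ((L - prho p) * (c + k * E)) by ring.
  have -> : 8 * lam * (e * (k ^+ 2 / 4 * E)) * prho p = e * (2 * (lam * k * prho p) * (k * E)) by field.
  rewrite ltr_pM2l //.
  have lk : L + 1 <= lam * k * prho p.
    have -> : L + 1 = lam * k * delta by rewrite /k; field; rewrite !gt_eqF.
    have lk0 : 0 < lam * k by exact: mulr_gt0.
    by rewrite ler_pM2l // ltW.
  have b1 : 2 * (L + 1) * (k * E) <= 2 * (lam * k * prho p) * (k * E).
    by rewrite ler_pM2r // ler_pM2l.
  apply: lt_le_trans b1; have [Lp|Lp] := leP L (prho p).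
    apply: (@le_lt_trans _ _ 0).
      by rewrite mulr_le0_ge0 ?subr_le0 // addr_ge0 // ltW.
    by rewrite mulr_gt0 // mulr_gt0 // ltr_wpDl.
  have cE : c <= k * E.
    rewrite /c ler_pM2l // /E ler_expR lerN2 mulrC ler_pM2r //; exact: ltW.
  have rp0 : 0 < prho p by exact: lt_trans pd.
  have LL : (L - prho p) * (c + k * E) <= L * (2 * (k * E)).
    apply: ler_pM; rewrite ?subr_ge0 ?(ltW Lp) //.
    - by rewrite addr_ge0 // ltW.
    - by rewrite lerBlDr lerDl ltW.
    - by lra.
  by apply: le_lt_trans LL _; lra.
(* On the sphere, [p.1 >= -1/2] forces [rho >= delta], with equality only at [-1/2]. *)
have p12 : p.1 = - 2^-1.
  apply/eqP; rewrite eq_le p1 andbT; move: pd; rewrite rp ler_pdivrMr ?oppr_gt0 //.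
  rewrite /s mulrN -mulrN ler_pM2l // => h; lra.
exists p.2 => // q Qq q0 dq; apply: le_trans (sphere q Qq q0 dq) _.
rewrite /Psi p12; suff -> : prho p = delta by [].
by rewrite rp p12 /s; field.
Qed.

End Level.

Lemma w_le_center t x : Q1 d (t, x) -> t < 0 -> x <> 0 -> w t x <= w (- 2^-1) 0.
Proof.
move=> Qt t0 x0.
have xs : 0 < sqnorm x.
  by rewrite lt_neqAle sqnorm_ge0 andbT eq_sym; apply/eqP => /sqnorm_eq0.
have rt : 0 < prho (t, x) by rewrite divr_gt0 // oppr_gt0.
apply/ler_addgt0Pl => iota i0.
have Qc : Q1 d (- 2^-1, 0 : 'rV[R]_d).
  by split; rewrite /= /B1 /eball /= ?sqnorm0 ?expr1n ?ltr01 //; apply/andP; split; lra.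
have c0 : ((- 2^-1 : R), (0 : 'rV[R]_d)).1 < 0 by rewrite /=; lra.
have := w_continuous Qc c0 => /cvgrPdist_lt /(_ _ i0) /nbhs_polydisc[e e0 He].
(* The first bound brings [(t, x)] into the range [rho >= delta]; the last puts the sphere of
   squared radius [delta / 2] where [w] at time [-1/2] is within [iota] of its central value. *)
pose delta := Num.min (Num.min (prho (t, x)) 2^-1) (e ^+ 2).
have dl0 : 0 < delta by rewrite !lt_min rt exprn_gt0 // andbT invr_gt0 ltr0n.
have dl1 : delta < 1.
  by apply: (@le_lt_trans _ _ 2^-1); [rewrite !ge_min lexx ?orbT|lra].
have dlr : delta <= prho (t, x) by rewrite !ge_min lexx.
set L := 2 * d%:R * Lam; pose k := (L + 1) / (lam * delta).
pose c := k * expR (- (L * k)).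
(* With [delta] fixed, the weight [eps] of the barrier tends to [0]. *)
apply: (@le_of_small _ _ _ (barrier k c (prho (t, x)) - barrier k c delta) 1 ltr01) => eps /andP[eps0 _].
have [y ys Hy] := Psi_max_level dl0 dl1 eps0.
have := Hy (t, x) Qt t0 dlr; rewrite -/L -/k -/c /=.
have : `|w (- 2^-1) 0 - w (- 2^-1) y| < iota.
  apply: (He (- 2^-1, y)); apply: coordsP => [|j]; first by rewrite dcoords_t subrr normr0.
  rewrite dcoords_x /= mxE subr0.
  have : y 0 j ^+ 2 < e ^+ 2.
    apply: (@le_lt_trans _ _ (sqnorm y)).
      by rewrite /sqnorm (bigD1 j) //= lerDl; apply: sumr_ge0 => i _; exact: sqr_ge0.
    have : delta <= e ^+ 2 by rewrite ge_min lexx orbT.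
    by rewrite ys; lra.
  by rewrite -real_normK ?num_real // ltr_pXn2r ?nnegrE // ltW.
rewrite distrC => h1; have := le_lt_trans (ler_norm _) h1; rewrite -/w.
by rewrite mulrDl mulNr ![_ * eps]mulrC; lra.
Qed.

End MaxPrinciple.

(** * Passage to the opposite function *)

Section Negation.
Context {R : realType} {d : nat}.
Implicit Types (p q : R * 'rV[R]_d) (u : R -> 'rV[R]_d -> R).
Implicit Types (c : ('I_d.+1 -> nat) -> R) (x : 'rV[R]_d) (r : R).

Lemma psreprN u p r c : psrepr u p r c -> psrepr (fun t x => - u t x) p r (fun a => - c a).
Proof.
move=> [r0 ca uE]; split=> //.
  by have := absconvB (@absconv0 R d.+1 r) ca; under eq_fun do rewrite sub0r.
move=> q qr q0; rewrite uE //; apply/esym/cvg_lim; first exact: Rhausdorff.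
rewrite (_ : psum _ _ = fun N => - psum c (dcoords p q) N).
  by apply: cvgN; exact: (pwsum_cvg r0 ca qr).
apply/funext => N; rewrite -mulN1r -psumZ; congr psum; apply/funext => a.
by rewrite mulN1r.
Qed.

Lemma pdtN u p r c : psrepr u p r c -> p.1 < 0 ->
  pdt (fun t x => - u t x) p.1 p.2 = - pdt u p.1 p.2.
Proof.
move=> ru p0; rewrite (psrepr_center (psrepr_pdt (psreprN ru)) p0).
by rewrite (psrepr_center (psrepr_pdt ru) p0) /sh mulrN.
Qed.

Lemma hessN u p r c : psrepr u p r c -> p.1 < 0 ->
  hess (fun t x => - u t x) p.1 p.2 = - hess u p.1 p.2.
Proof.
move=> ru p0; rewrite (psrepr_hess (psreprN ru) p0) (psrepr_hess ru p0).
by apply/matrixP => i j; rewrite !mxE /sh !mulrN.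
Qed.

(** This is the operator of the equation solved by [- u]. The bounds are those of [F] at [- (A + B)]
    with increment [B]. *)
Lemma unif_ellipticN (F : 'M[R]_d -> R) (lam Lam : R) : unif_elliptic F lam Lam ->
  unif_elliptic (fun A => - F (- A)) lam Lam.
Proof.
move=> FE A B sA sB pB.
have sAB : symmetric_mx (- (A + B)) by rewrite /symmetric_mx linearN /= linearD /= sA sB.
have [] := FE _ _ sAB sB pB.
by rewrite opprD subrK opprK [- F (- A - B) + _]addrC.
Qed.

End Negation.

Lemma near_eq_continuous_at {R : realType} (T : topologicalType) (g h : T -> R) (x : T)
    (B : set T) : nbhs x B -> B x -> (forall y, B y -> g y = h y) ->
  {for x, continuous g} -> {for x, continuous h}.
Proof.
move=> nB Bx gh gc; rewrite /prop_for /continuous_at -gh //.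
apply: cvg_trans gc; apply: near_eq_cvg.
by apply: filterS nB => y /gh.
Qed.

(** * Constancy of the time derivative and regularity of the terminal slice *)

Section Conclusion.
Context {R : realType} {d : nat}.
Implicit Types (p q : R * 'rV[R]_d) (x : 'rV[R]_d).
Variables (F : 'M[R]_d -> R) (lam Lam : R) (u : R -> 'rV[R]_d -> R).
Hypotheses (d0 : (0 < d)%N) (lam0 : 0 < lam) (lamLam : lam <= Lam) (FE : unif_elliptic F lam Lam).
Hypothesis ucont : {within Q1 d, continuous (fun p : R * 'rV[R]_d => u p.1 p.2)}.
Hypothesis uan : forall p, Q1 d p -> p <> (0, 0) -> exists r c, crepr u p r c.
Hypothesis upde : forall q, Q1 d q -> q.1 < 0 -> pdt u q.1 q.2 = F (hess u q.1 q.2).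
Hypothesis uhom : forall (a : R) x, 0 < a -> B1 d x -> B1 d (a *: x) ->
  u 0 (a *: x) = a ^+ 2 * u 0 x.

Let an p : Q1 d p -> p <> (0, 0) -> exists r c, psrepr u p r c.
Proof.
by move=> Qp p0; have [r [c rc]] := uan Qp p0; exists r, c; exact: crepr_psrepr.
Qed.

Let an_neg p : Q1 d p -> p.1 < 0 -> exists r c, psrepr u p r c.
Proof. by move=> Qp p0; apply: an Qp _ => E; move: p0; rewrite E ltxx. Qed.

Let m := pdt u (- 2^-1) 0.

Lemma pdt_constant t x : Q1 d (t, x) -> t < 0 -> x <> 0 -> pdt u t x = m.
Proof.
move=> Qt t0 x0; have wself := pdt_self_similar (ltW lam0) FE uan upde uhom.
apply/eqP; rewrite eq_le; apply/andP; split.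
  exact: (w_le_center d0 lam0 lamLam FE an upde wself).
have Qc : Q1 d (- 2^-1, 0 : 'rV[R]_d).
  by split; rewrite /= /B1 /eball /= ?sqnorm0 ?expr1n ?ltr01 //; apply/andP; split; lra.
have c0 : ((- 2^-1 : R), (0 : 'rV[R]_d)).1 < 0 by rewrite /=; lra.
pose v (t : R) x := - u t x.
have vt p : Q1 d p -> p.1 < 0 -> pdt v p.1 p.2 = - pdt u p.1 p.2.
  by move=> Qp p0; have [r [c ru]] := an_neg Qp p0; exact: pdtN ru p0.
have := @w_le_center _ _ (fun A => - F (- A)) lam Lam v d0 lam0 lamLam (unif_ellipticN FE).
have H1 p : Q1 d p -> p <> (0, 0) -> exists r c, psrepr v p r c.
  by move=> Qp p0; have [r [c ru]] := an Qp p0; exists r, (fun a => - c a); exact: psreprN.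
have H2 q : Q1 d q -> q.1 < 0 -> pdt v q.1 q.2 = - F (- hess v q.1 q.2).
  move=> Qq q0; have [r [c ru]] := an_neg Qq q0.
  by rewrite (pdtN ru q0) (hessN ru q0) opprK upde.
have H3 (a t' : R) (y : 'rV[R]_d) : 0 < a <= 1 -> y <> 0 -> Q1 d (t', y) -> t' < 0 ->
    pdt v (a ^+ 2 * t') (a *: y) = pdt v t' y.
  move=> a01 y0 Qy t'0; rewrite (vt (t', y)) //.
  have at0 : a ^+ 2 * t' < 0 by case/andP: a01 => a0 _; rewrite pmulr_rlt0 // exprn_gt0.
  by rewrite (vt (a ^+ 2 * t', a *: y)) //= ?wself //; exact: (Q1_scal a01 Qy).
move=> /(_ H1 H2 H3 t x Qt t0 x0).
by rewrite (vt (t, x)) // (vt (- 2^-1, 0)) //= lerN2.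
Qed.

(** The interval [[-1/2, 0]] is split at [- e]: next to [0] the mean value theorem is applied to the
    power series [g], which is differentiable on both sides of [0], and further back to [u] itself.
    The two increments [m e] and [m (1/2 - e)] add up. *)
Lemma terminal_value x : B1 d x -> x <> 0 -> u 0 x = u (- 2^-1) x + m / 2.
Proof.
move=> xB x0.
have Q (t : R) : -1 < t <= 0 -> Q1 d (t, x) by move=> tI; split.
have [||r [c rc]] := uan (Q 0 _); [by rewrite lexx andbT; lra|by case|].
have [r0 ca uE] := rc.
pose e := Num.min (r / 2) 2^-1.
have e0 : 0 < e by rewrite lt_min divr_gt0 // invr_gt0 ltr0n.
have er : e < r by apply: (@le_lt_trans _ _ (r / 2)); [rewrite ge_min lexx|lra].
have e2 : e <= 2^-1 by rewrite ge_min lexx orbT.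
pose g (t : R) := pwsum (iter 0 (sh ord0) c) (dcoords (0, x) (t, x)).
pose dg (t : R) := pwsum (iter 1 (sh ord0) c) (dcoords (0, x) (t, x)).
have pr (t : R) : `|t| < r -> forall i, `|dcoords (0, x) (t, x) i| < r.
  by apply: polydisc_time => i; rewrite dcoords_id normr0.
have gd (t : R) : `|t| < r -> is_derive t (1 : R) g (dg t).
  by move=> tr; apply: (is_derive_tseries (r := r)) => //; exact: pr.
have gu (t : R) : `|t| < r -> t <= 0 -> g t = u t x.
  by move=> tr t0; have [_ /= ->] := uE (t, x) (pr t tr) t0.
have en (t : R) : t \in `[- e, 0]%R -> `|t| < r.
  by rewrite in_itv /= => /andP[t1 t2]; rewrite ler0_norm //; lra.
have gc : {within `[- e, 0], continuous g}.
  by apply: derivable_within_continuous => t /en /gd [].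
have [||s] := @MVT _ g dg (- e) 0 _ _ gc; first by rewrite oppr_lt0.
  by move=> t /subset_itv_oo_cc /en; exact: gd.
rewrite in_itv /= => /andP[s1 s2].
have sr : `|s| < r by rewrite ler0_norm ?(ltW s2) //; lra.
have -> : dg s = m.
  have [_ _ /(_ (s, x) (pr s sr) s2) /= H] := psrepr_pdt (crepr_psrepr rc).
  by rewrite /dg /= -H; apply: pdt_constant => //; apply: Q; apply/andP; split; lra.
have er' : `|- e| < r by rewrite normrN gtr0_norm.
rewrite !gu ?normr0 // ?oppr_le0 ?(ltW e0) // opprK add0r => E1.
have ud (t : R) : -1 < t -> t < 0 -> is_derive t (1 : R) (fun s => u s x) m.
  move=> t1 t0; have Qt : Q1 d (t, x) by apply: Q; rewrite t1 ltW.
  have [r' [c' [r'0 ca' uE']]] := an_neg Qt t0.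
  have := @psrepr_is_derive_t _ _ u (t, x) r' c' (t, x) (And3 r'0 ca' uE') _ t0.
  have -> /= : pwsum (sh ord0 c') (dcoords (t, x) (t, x)) = m.
    have [_ _ /(_ (t, x) _ t0) /= <-] := psrepr_pdt (And3 r'0 ca' uE').
      by exact: pdt_constant.
    by move=> i; rewrite dcoords_id normr0.
  by apply => i; rewrite dcoords_id normr0.
have e2' : - 2^-1 <= - e by rewrite lerN2.
have uI (t : R) : t \in `[- 2^-1, - e]%R -> -1 < t /\ t < 0.
  by rewrite in_itv /= => /andP[t1 t2]; split; lra.
have uc : {within `[- 2^-1, - e], continuous (fun s => u s x)}.
  by apply: derivable_within_continuous => t /uI [t1 t2]; have [] := ud t t1 t2.
have [|s' _] := @MVT_segment _ (fun s => u s x) (fun=> m) _ _ e2' _ uc.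
  by move=> t /subset_itv_oo_cc /uI [t1 t2]; exact: ud.
lra.
Qed.

(** The time line through [x = 0] ends at the singular point, so there the identity is obtained from
    points [y -> 0], by continuity of [u] at [(0, 0)] within [Q1] and at [(-1/2, 0)]. *)
Lemma terminal_value0 x : B1 d x -> u 0 x = u (- 2^-1) x + m / 2.
Proof.
move=> xB; have [->|/eqP x0] := eqVneq x 0; last exact: terminal_value.
have Qc : Q1 d (- 2^-1, 0 : 'rV[R]_d).
  by split; rewrite /= /B1 /eball /= ?sqnorm0 ?expr1n ?ltr01 //; apply/andP; split; lra.
have c0 : ((- 2^-1 : R), (0 : 'rV[R]_d)).1 < 0 by rewrite /=; lra.
have Q0 : Q1 d (0, 0 : 'rV[R]_d).
  by split; rewrite /= /B1 /eball /= ?sqnorm0 ?expr1n ?ltr01 // lexx andbT; lra.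
have [r [c ru]] := an_neg Qc c0.
apply/eqP; rewrite -subr_eq0 -normr_le0; apply/ler_addgt0Pl => eta eta0; rewrite addr0.
have eta2 : 0 < eta / 2 by rewrite divr_gt0.
have /cvgrPdist_lt /(_ _ eta2) /nbhs_polydisc[e1 e10 He1] := psrepr_cont ru c0.
have /subspace_continuousP /(_ _ Q0) /cvgrPdist_lt /(_ _ eta2) := ucont.
move=> /nbhs_polydisc[e2 e20 He2].
pose k := Num.min (Num.min e1 e2) 1 / 2.
have k0 : 0 < k by rewrite divr_gt0 // !lt_min e10 e20 ltr01.
have kmin : k < Num.min (Num.min e1 e2) 1 by move: k0; rewrite /k; lra.
have [k1 k2 k3] : [/\ k < e1, k < e2 & k < 1].
  by move: kmin; rewrite !lt_min => /andP[/andP[-> ->] ->].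
pose y : 'rV[R]_d := k *: delta_mx 0 (Ordinal d0).
have yj j : `|y 0 j| <= k.
  by rewrite !mxE eqxx /=; case: (_ == _); rewrite ?mulr1 ?mulr0 ?normr0 ?gtr0_norm // ltW.
have y0 : y <> 0.
  move=> /rowP /(_ (Ordinal d0)); rewrite !mxE !eqxx mulr1 => E.
  by move: k0; rewrite E ltxx.
have yB : B1 d y.
  rewrite /B1 /eball /= expr1n sqnormZ /sqnorm (bigD1 (Ordinal d0)) //= mxE !eqxx expr1n.
  rewrite big1 ?addr0 ?mulr1; first by rewrite expr_lt1 // ltW.
  by move=> i /negbTE ii; rewrite mxE eqxx ii expr0n.
have h1 : `|u (- 2^-1) 0 - u (- 2^-1) y| < eta / 2.
  apply: (He1 (- 2^-1, y)); apply: coordsP => [|j]; first by rewrite dcoords_t subrr normr0.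
  by rewrite dcoords_x /= [X in _ - X]mxE subr0 (le_lt_trans (yj j)).
have h2 : `|u 0 0 - u 0 y| < eta / 2.
  apply: (He2 (0, y)); last by split=> //=; rewrite lexx andbT; lra.
  apply: coordsP => [|j]; first by rewrite dcoords_t subrr normr0.
  by rewrite dcoords_x /= [X in _ - X]mxE subr0 (le_lt_trans (yj j)).
have E := terminal_value yB y0.
have -> : u 0 0 - (u (- 2^-1) 0 + m / 2) =
  (u 0 0 - u 0 y) - (u (- 2^-1) 0 - u (- 2^-1) y) by rewrite E; ring.
apply: le_trans (ler_normB _ _) _; lra.
Qed.

Lemma slice_continuous (f : R -> 'rV[R]_d -> R) (t : R) x r c : psrepr f (t, x) r c -> t < 0 ->
  {for x, continuous (f t)}.
Proof.
move=> rf t0; have fc := psrepr_cont rf t0.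
move=> A fA; have /nbhs_polydisc[e1 e10 He] := fc A fA.
have := nbhsx_ballx x _ e10; apply: filterS => y [_ yb].
apply: (He (t, y)); apply: coordsP => [|j]; first by rewrite dcoords_t subrr normr0.
by rewrite dcoords_x /= distrC; exact: yb.
Qed.

(** The identity of slices holds on the whole open ball, so derivatives transfer one order at a
    time: agreement of the first derivatives on the ball makes the second ones comparable. *)
Lemma terminal_C2 : C2_on (u 0) (eball d 1).
Proof.
have B1n x : B1 d x -> \forall y \near x, B1 d y.
  move=> xB; have := @sqnorm_continuous R d x => /cvgr_lt /(_ 1).
  rewrite /B1 /eball /= in xB *; rewrite expr1n in xB *.
  by apply.
have t0 : - 2^-1 < 0 :> R by lra.
have Q x : B1 d x -> Q1 d (- 2^-1, x) by move=> xB; split=> //=; apply/andP; split; lra.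
have cn (g h : 'rV[R]_d -> R) x : B1 d x -> (forall y, B1 d y -> g y = h y) ->
    {for x, continuous g} -> {for x, continuous h}.
  by move=> xB; exact: (near_eq_continuous_at (B1n x xB) xB).
have dn (g h : 'rV[R]_d -> R) x v l : B1 d x -> (forall y, B1 d y -> g y = h y) ->
    is_derive x v g l -> is_derive x v h l.
  move=> xB gh gd; apply: near_eq_is_derive gd.
  by have := B1n x xB; apply: filterS => y /gh.
have g0 y : B1 d y -> u (- 2^-1) y + m / 2 = u 0 y by move=> /terminal_value0.
have du x i : B1 d x -> is_derive x (evec i) (u 0) (pdx i u (- 2^-1) x).
  move=> xB; have [r [c ru]] := an_neg (Q x xB) t0; have [r0 _ _] := ru.
  apply: dn xB g0 _.
  have := @psrepr_is_derive_x _ _ u (- 2^-1, x) r c (- 2^-1, x) (evec i) ru.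
  rewrite dirsh_x dcoords_id /= => /(_ _ t0) H.
  have -> : pdx i u (- 2^-1) x = pwsum (sh (xi i) c) (fun=> 0) + 0.
    have := psrepr_center (psrepr_pdx i ru) t0; rewrite /= => ->.
    by rewrite pwsum0 addr0.
  have -> : (fun y => u (- 2^-1) y + m / 2) = u (- 2^-1) + cst (m / 2) by [].
  by apply: is_deriveD; apply: H => j; rewrite normr0.
have d1 i y : B1 d y -> pdx i u (- 2^-1) y = pdx1 i (u 0) y.
  by move=> yB; have [_ <-] := du y i yB.
have ddu x i j : B1 d x ->
    is_derive x (evec i) (pdx1 j (u 0)) (pdx i (pdx j u) (- 2^-1) x).
  move=> xB; have [r [c ru]] := an_neg (Q x xB) t0; have [r0 _ _] := ru.
  apply: dn xB (d1 j) _.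
  have := @psrepr_is_derive_x _ _ (pdx j u) (- 2^-1, x) r _ (- 2^-1, x) (evec i) (psrepr_pdx j ru).
  rewrite dirsh_x dcoords_id /= => /(_ _ t0) H.
  have := psrepr_center (psrepr_pdx i (psrepr_pdx j ru)) t0; rewrite /= => ->.
  by rewrite -pwsum0; apply: H => l; rewrite normr0.
have d2 i j y : B1 d y -> pdx i (pdx j u) (- 2^-1) y = pdx1 i (pdx1 j (u 0)) y.
  by move=> yB; have [_ <-] := ddu y i j yB.
move=> x xB; have [r [c ru]] := an_neg (Q x xB) t0.
do !split.
- by move=> i; have [] := du x i xB.
- by move=> i j; have [] := ddu x i j xB.
- have H : {for x, continuous (u (- 2^-1) + cst (m / 2))}.
    by apply: continuousD; [exact: slice_continuous ru t0|exact: cst_continuous].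
  exact: cn xB g0 H.
- by move=> i; apply: cn xB (d1 i) _; exact: slice_continuous (psrepr_pdx i ru) t0.
- move=> i j; apply: cn xB (d2 i j) _.
  exact: slice_continuous (psrepr_pdx i (psrepr_pdx j ru)) t0.
Qed.

End Conclusion.

Unset Implicit Arguments.

Theorem theorem1p3 (R : realType) (d : nat) (lam Lam : R) (F : 'M[R]_d -> R) :
  (0 < d)%N -> 0 < lam -> lam <= Lam -> unif_elliptic F lam Lam ->
  ~ exists u : R -> 'rV[R]_d -> R,
      visc_solution F u /\
      (forall p, Q1 d p -> p <> (0, 0) -> analytic_at_Q1 u p) /\
      (forall (a : R) (x : 'rV[R]_d), 0 < a -> B1 d x -> B1 d (a *: x) ->
         u 0 (a *: x) = a ^+ 2 * u 0 x) /\
      ~ (exists r : R, 0 < r /\ r <= 1 /\ C2_on (u 0) (eball d r)).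
Proof.
move=> d0 lam0 lamLam FE [u [uv [ua [uhom nC2]]]]; apply: nC2.
exists 1; split; first exact: ltr01.
split; first exact: lexx.
have uan p : Q1 d p -> p <> (0, 0) -> exists r c, crepr u p r c.
  by move=> Qp p0; apply: crepr_of_analytic => //; exact: ua.
apply: (terminal_C2 d0 lam0 lamLam FE _ uan _ uhom); first by case: uv.
move=> q Qq q0; have [|r [c rc]] := uan q Qq.
  by move=> E; move: q0; rewrite E ltxx.
have ru := crepr_psrepr rc.
rewrite (psrepr_center (psrepr_pdt ru) q0) (psrepr_hess ru q0).
exact: (visc_classical (ltW lam0) FE uv Qq q0 ru).
Qed.
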